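(* Let $\mathcal{C}$ be a premodular category and let $\mathcal{D}$ be a fusion subcategory of $\mathcal{C}$. If $\mathcal{D}\cap \mathcal{Z}_2(\mathcal{C})=\mathrm{Vec}$, then $$\frac{\dim(\mathcal{C})}{\dim(Y)^2}\in \mathbb{A}$$ for any simple object $Y$ of $\mathcal{D}$.
   Context: All fusion categories are over $\mathbb{C}$. A premodular category is a braided fusion category equipped with a spherical structure (a pivotal structure $j:\mathrm{id}_{\mathcal{C}}\to ()^{**}$ with $\dim(V)=\dim(V^* )$ for all objects $V$). $\dim(X)$ is the categorical dimension with respect to this structure, and $\dim(\mathcal{C})=\sum_{X}\dim(X)^2$, the sum being over isomorphism classes of simple objects. Two objects $X,Y$ of $\mathcal{C}$ centralize each other if $c_{Y,X}c_{X,Y}=\mathrm{id}_{X\otimes Y}$, where $c$ is the braiding. The Müger center $\mathcal{Z}_2(\mathcal{C})=\mathcal{C}'$ is the fusion subcategory of $\mathcal{C}$ generated by all simple objects centralizing every object of $\mathcal{C}$. $\mathrm{Vec}$ is the fusion subcategory generated by the unit object. $\mathbb{A}$ is the ring of algebraic integers. *)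

(* Defs.v *)
(* Conventions follow Etingof-Gelaki-Nikshych-Ostrik, "Tensor Categories":
   composition [g \oc f] is "g after f", the associator goes from
   (X (x) Y) (x) Z to X (x) (Y (x) Z), and X^* is a left dual of X, i.e.
   ev : X^* (x) X -> 1 and coev : 1 -> X (x) X^*. *)
From HB Require Import structures.
From mathcomp Require Import all_boot all_order all_algebra.
From mathcomp Require Import boolp classical_sets reals.
From mathcomp.real_closed Require Export complex.
Export boolp classical_sets reals.
Set Implicit Arguments.
Unset Strict Implicit.
Unset Printing Implicit Defensive.
Import GRing.Theory.
Local Open Scope ring_scope.
Local Open Scope classical_set_scope.

Reserved Notation "g \oc f" (at level 50, left associativity).
Reserved Notation "X \ox Y" (at level 40, left associativity).
Reserved Notation "f \om g" (at level 40, left associativity).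

(* A [vectType] value for [Hom] makes the morphism spaces finite-dimensional. *)
Record linear_category (K : fieldType) := LinearCategory {
  ob :> Type;
  Hom : ob -> ob -> vectType K;
  idm : forall X, Hom X X;
  compm : forall X Y Z, Hom Y Z -> Hom X Y -> Hom X Z;
  compmA : forall X Y Z W (h : Hom Z W) (g : Hom Y Z) (f : Hom X Y),
    compm h (compm g f) = compm (compm h g) f;
  comp1m : forall X Y (f : Hom X Y), compm (idm Y) f = f;
  compm1 : forall X Y (f : Hom X Y), compm f (idm X) = f;
  comp_linearl : forall X Y Z (f : Hom X Y),
    linear (fun g : Hom Y Z => compm g f);
  comp_linearr : forall X Y Z (g : Hom Y Z),
    linear (fun f : Hom X Y => compm g f)
}.

Arguments Hom {K l} X Y.
Arguments idm {K l} X.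
Arguments compm {K l X Y Z} g f.
Notation "g \oc f" := (compm g f).

Section LinearCategory.
Variables (K : fieldType) (C : linear_category K).

Definition is_iso (X Y : C) (f : Hom X Y) : Prop :=
  exists g : Hom Y X, g \oc f = idm X /\ f \oc g = idm Y.

Definition isomorphic (X Y : C) : Prop := exists f : Hom X Y, is_iso f.

Definition mono (X Y : C) (f : Hom X Y) : Prop :=
  forall Z (g h : Hom Z X), f \oc g = f \oc h -> g = h.

Definition epi (X Y : C) (f : Hom X Y) : Prop :=
  forall Z (g h : Hom Y Z), g \oc f = h \oc f -> g = h.

Definition zero_object (X : C) : Prop :=
  forall Y, (forall f : Hom X Y, f = 0) /\ (forall f : Hom Y X, f = 0).

(* For n = 0 this says that X is a zero object. *)
Definition is_direct_sum (n : nat) (Xs : 'I_n -> C) (X : C) : Prop :=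
  exists (inj : forall k, Hom (Xs k) X) (proj : forall k, Hom X (Xs k)),
    [/\ forall k, proj k \oc inj k = idm (Xs k),
        forall k l, k != l -> proj l \oc inj k = 0
      & \sum_(k < n) (inj k \oc proj k) = idm X].

Definition is_kernel (X Y N : C) (f : Hom X Y) (k : Hom N X) : Prop :=
  f \oc k = 0 /\
  forall Z (g : Hom Z X), f \oc g = 0 -> exists! u : Hom Z N, k \oc u = g.

Definition is_cokernel (X Y Q : C) (f : Hom X Y) (q : Hom Y Q) : Prop :=
  q \oc f = 0 /\
  forall Z (g : Hom Y Z), g \oc f = 0 -> exists! u : Hom Q Z, u \oc q = g.

Record abelian_category : Prop := AbelianCategory {
  has_direct_sums : forall n (Xs : 'I_n -> C), exists X, is_direct_sum Xs X;
  has_kernels : forall (X Y : C) (f : Hom X Y),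
    exists N (k : Hom N X), is_kernel f k;
  has_cokernels : forall (X Y : C) (f : Hom X Y),
    exists Q (q : Hom Y Q), is_cokernel f q;
  mono_is_kernel : forall (N X : C) (k : Hom N X), mono k ->
    exists Y (f : Hom X Y), is_kernel f k;
  epi_is_cokernel : forall (Y Q : C) (q : Hom Y Q), epi q ->
    exists X (f : Hom X Y), is_cokernel f q
}.

Definition simple_object (X : C) : Prop :=
  ~ zero_object X /\
  forall Z (m : Hom Z X), mono m -> zero_object Z \/ is_iso m.

Definition semisimple_category : Prop :=
  forall X : C, exists n (Xs : 'I_n -> C),
    (forall k, simple_object (Xs k)) /\ is_direct_sum Xs X.

Definition simple_representatives (n : nat) (S : 'I_n -> C) : Prop :=
  [/\ forall i, simple_object (S i),
      forall i j, isomorphic (S i) (S j) -> i = j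
    & forall X, simple_object X -> exists i, isomorphic X (S i)].

End LinearCategory.

Record monoidal_category (K : fieldType) := MonoidalCategory {
  mon_cat :> linear_category K;
  unit_ob : mon_cat;
  tens : mon_cat -> mon_cat -> mon_cat;
  tensm : forall X Y Z W : mon_cat,
    Hom X Y -> Hom Z W -> Hom (tens X Z) (tens Y W);
  tensm1 : forall X Y, tensm (idm X) (idm Y) = idm (tens X Y);
  tensm_comp : forall X Y Z X' Y' Z' (g : Hom Y Z) (f : Hom X Y)
      (g' : Hom Y' Z') (f' : Hom X' Y'),
    tensm (g \oc f) (g' \oc f') = tensm g g' \oc tensm f f';
  tensm_linearl : forall X Y Z W (g : Hom Z W),
    linear (fun f : Hom X Y => tensm f g);
  tensm_linearr : forall X Y Z W (f : Hom X Y),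
    linear (fun g : Hom Z W => tensm f g);
  assoc : forall X Y Z, Hom (tens (tens X Y) Z) (tens X (tens Y Z));
  assocV : forall X Y Z, Hom (tens X (tens Y Z)) (tens (tens X Y) Z);
  lunit : forall X, Hom (tens unit_ob X) X;
  lunitV : forall X, Hom X (tens unit_ob X);
  runit : forall X, Hom (tens X unit_ob) X;
  runitV : forall X, Hom X (tens X unit_ob);
  assocK : forall X Y Z, assocV X Y Z \oc assoc X Y Z = idm _;
  assocVK : forall X Y Z, assoc X Y Z \oc assocV X Y Z = idm _;
  lunitK : forall X, lunitV X \oc lunit X = idm _;
  lunitVK : forall X, lunit X \oc lunitV X = idm _;
  runitK : forall X, runitV X \oc runit X = idm _;
  runitVK : forall X, runit X \oc runitV X = idm _;
  assoc_natural : forall X Y Z X' Y' Z'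
      (f : Hom X X') (g : Hom Y Y') (h : Hom Z Z'),
    assoc X' Y' Z' \oc tensm (tensm f g) h =
    tensm f (tensm g h) \oc assoc X Y Z;
  lunit_natural : forall X Y (f : Hom X Y),
    lunit Y \oc tensm (idm unit_ob) f = f \oc lunit X;
  runit_natural : forall X Y (f : Hom X Y),
    runit Y \oc tensm f (idm unit_ob) = f \oc runit X;
  pentagon : forall W X Y Z,
    assoc W X (tens Y Z) \oc assoc (tens W X) Y Z =
    tensm (idm W) (assoc X Y Z) \oc assoc W (tens X Y) Z
      \oc tensm (assoc W X Y) (idm Z);
  triangle : forall X Y,
    tensm (idm X) (lunit Y) \oc assoc X unit_ob Y = tensm (runit X) (idm Y)
}.

Arguments unit_ob {K} m.
Arguments tens {K m} X Y.
Arguments tensm {K m X Y Z W} f g.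
Arguments assoc {K m} X Y Z.
Arguments assocV {K m} X Y Z.
Arguments lunit {K m} X.
Arguments lunitV {K m} X.
Arguments runit {K m} X.
Arguments runitV {K m} X.
Notation "X \ox Y" := (tens X Y).
Notation "f \om g" := (tensm f g).

Section MonoidalCategory.
Variables (K : fieldType) (C : monoidal_category K).
Local Notation "1" := (unit_ob C).

(* A -> A 1 -> A (B A') -> (A B) A' -> 1 A' -> A' *)
Definition bend (A B A' : C) (e : Hom (A \ox B) 1) (c : Hom 1 (B \ox A')) :
    Hom A A' :=
  lunit A' \oc (e \om idm A') \oc assocV A B A' \oc (idm A \om c)
    \oc runitV A.

(* A -> 1 A -> (A' B) A -> A' (B A) -> A' 1 -> A' *)
Definition bendr (A B A' : C) (e : Hom (B \ox A) 1) (c : Hom 1 (A' \ox B)) :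
    Hom A A' :=
  runit A' \oc (idm A' \om e) \oc assoc A' B A \oc (c \om idm A)
    \oc lunitV A.

Definition is_left_dual (X Xs : C) (e : Hom (Xs \ox X) 1)
    (c : Hom 1 (X \ox Xs)) : Prop :=
  bendr e c = idm X /\ bend e c = idm Xs.

End MonoidalCategory.

(* The left duals are chosen, so that X |-> X^** is a functor. The last field
   says that every object has a right dual. *)
Record rigid_category (K : fieldType) := RigidCategory {
  rigid_mon :> monoidal_category K;
  dual : rigid_mon -> rigid_mon;
  ev : forall X, Hom (dual X \ox X) (unit_ob rigid_mon);
  coev : forall X, Hom (unit_ob rigid_mon) (X \ox dual X);
  left_dualP : forall X, is_left_dual (ev X) (coev X);
  has_right_dual : forall X : rigid_mon,
    exists (Y : rigid_mon) (e : Hom (X \ox Y) (unit_ob rigid_mon))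
           (c : Hom (unit_ob rigid_mon) (Y \ox X)), is_left_dual e c
}.

Arguments dual {K r} X.
Arguments ev {K r} X.
Arguments coev {K r} X.

Section RigidCategory.
Variables (K : fieldType) (C : rigid_category K).
Local Notation "1" := (unit_ob C).

Definition dualm (X Y : C) (f : Hom X Y) : Hom (dual Y) (dual X) :=
  bend (ev Y) ((f \om idm (dual X)) \oc coev X).

(* (Y^* X^* ) (X Y) -> Y^* (X^* (X Y)) -> Y^* ((X^* X) Y) -> Y^* (1 Y)
   -> Y^* Y -> 1 *)
Definition ev_tens (X Y : C) : Hom ((dual Y \ox dual X) \ox (X \ox Y)) 1 :=
  ev Y \oc (idm (dual Y) \om lunit Y) \oc (idm (dual Y) \om (ev X \om idm Y))
    \oc (idm (dual Y) \om assocV (dual X) X Y)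
    \oc assoc (dual Y) (dual X) (X \ox Y).

(* The canonical isomorphism Y^* X^* -> (X Y)^*, i.e. the comparison between
   two left duals of X Y. *)
Definition dual_tens (X Y : C) : Hom (dual Y \ox dual X) (dual (X \ox Y)) :=
  bend (ev_tens X Y) (coev (X \ox Y)).

End RigidCategory.

Record fusion_category (K : fieldType) := FusionCategory {
  fusion_rigid :> rigid_category K;
  fusion_abelian : abelian_category fusion_rigid;
  fusion_semisimple : semisimple_category fusion_rigid;
  fusion_finite : exists (n : nat) (S : 'I_n -> fusion_rigid),
    simple_representatives S;
  (* End(1) = K *)
  fusion_unit : forall f : Hom (unit_ob fusion_rigid) (unit_ob fusion_rigid),
    exists! a : K, f = a *: idm (unit_ob fusion_rigid)
}.

Section FusionCategory.
Variables (K : fieldType) (C : fusion_category K).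

Definition unit_scalar (f : Hom (unit_ob C) (unit_ob C)) : K :=
  projT1 (cid (fusion_unit f)).

Definition fusion_rank : nat := projT1 (cid (fusion_finite C)).

Definition irr : 'I_fusion_rank -> C :=
  projT1 (cid (projT2 (cid (fusion_finite C)))).

(* A full subcategory, given by its set of objects. The field [fusub_sum]
   expresses closure under finite direct sums and under direct summands, in
   particular under isomorphisms. *)
Record fusion_subcategory (D : set C) : Prop := FusionSubcategory {
  fusub_unit : D (unit_ob C);
  fusub_tens : forall X Y, D X -> D Y -> D (X \ox Y);
  fusub_dual : forall X, D X -> D (dual X);
  fusub_sum : forall n (Xs : 'I_n -> C) (X : C), is_direct_sum Xs X ->
    (D X <-> forall k, D (Xs k))
}.

Definition generated_subcategory (S : set C) : set C :=
  smallest fusion_subcategory S.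

Definition Vec : set C := generated_subcategory [set unit_ob C].

End FusionCategory.

Arguments Vec {K} C.
Arguments irr {K C} i.
Arguments fusion_rank {K} C.

Record braided_fusion_category (K : fieldType) := BraidedFusionCategory {
  braided_fusion :> fusion_category K;
  braid : forall X Y : braided_fusion, Hom (X \ox Y) (Y \ox X);
  braid_iso : forall X Y, is_iso (braid X Y);
  braid_natural : forall X Y X' Y' (f : Hom X X') (g : Hom Y Y'),
    braid X' Y' \oc (f \om g) = (g \om f) \oc braid X Y;
  hexagon : forall X Y Z,
    assoc Y Z X \oc braid X (Y \ox Z) \oc assoc X Y Z =
    (idm Y \om braid X Z) \oc assoc Y X Z \oc (braid X Y \om idm Z);
  hexagonV : forall X Y Z,
    assocV Z X Y \oc braid (X \ox Y) Z \oc assocV X Y Z =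
    (braid X Z \om idm Y) \oc assocV X Z Y \oc (idm X \om braid Y Z)
}.

Arguments braid {K b} X Y.

Section MugerCenter.
Variables (K : fieldType) (C : braided_fusion_category K).

Definition centralize (X Y : C) : Prop :=
  braid Y X \oc braid X Y = idm (X \ox Y).

Definition muger_center : set C :=
  generated_subcategory
    [set X | simple_object X /\ forall Y : C, centralize X Y].

End MugerCenter.

Arguments muger_center {K} C.

(* [pivotal_tens] is monoidality of j : the canonical monoidal structure of
   the double dual functor is
     X^** Y^** -> (Y^* X^* )^* <- (X Y)^**,
   with arrows [dual_tens (dual Y) (dual X)] and [dualm (dual_tens X Y)].
   As j is invertible, its compatibility with units is automatic. *)
Record pivotal_structure (K : fieldType) (C : rigid_category K) :=
    PivotalStructure {
  piv :> forall X : C, Hom X (dual (dual X));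
  pivotal_iso : forall X, is_iso (piv X);
  pivotal_natural : forall X Y (f : Hom X Y),
    piv Y \oc f = dualm (dualm f) \oc piv X;
  pivotal_tens : forall X Y,
    dualm (dual_tens X Y) \oc piv (X \ox Y) =
    dual_tens (dual Y) (dual X) \oc (piv X \om piv Y)
}.

Definition pivotal_dim (K : fieldType) (C : fusion_category K)
    (j : pivotal_structure C) (X : C) : K :=
  unit_scalar (ev (dual X) \oc (j X \om idm (dual X)) \oc coev X).

Record premodular_category (K : fieldType) := PremodularCategory {
  premodular_braided :> braided_fusion_category K;
  spherical : pivotal_structure premodular_braided;
  sphericalP : forall X,
    pivotal_dim spherical X = pivotal_dim spherical (dual X)
}.

Arguments spherical {K} p.

Definition catdim (K : fieldType) (C : premodular_category K) (X : C) : K :=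
  pivotal_dim (spherical C) X.

Definition global_dim (K : fieldType) (C : premodular_category K) : K :=
  \sum_(i < fusion_rank C) catdim (irr i) ^+ 2.

Definition algebraic_integer (K : fieldType) (z : K) : Prop :=
  integralOver (intr : int -> K) z.

(* Main.v *)
From HB Require Import structures.
From mathcomp Require Import all_boot all_order all_algebra.
From mathcomp Require Import boolp classical_sets reals.
From mathcomp.real_closed Require Import complex.
Require Import Defs.
Set Implicit Arguments.
Unset Strict Implicit.
Unset Printing Implicit Defensive.
Import GRing.Theory VectorInternalTheory.
Local Open Scope ring_scope.
Local Open Scope classical_set_scope.

(** Write [d X] for the dimension of [X], [X_i] for the simple objects, and, for
    a simple [Z], let [h Z X] be the scalar by which a loop coloured by [X]
    around the strand [Z] acts ([loop], [loopval]). The proof rests on the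
    identity
      [dim C = d Y ^ 2 * \sum_i h Y X_i * h (dual Y) X_i]
    ([global_dim_loops]) together with the integrality of its right-hand
    factors.

    Integrality: by the hexagons and the monoidality of the pivotal structure
    [h Z] is multiplicative ([loop_tens]), and it is additive, so it is a
    character of the fusion ring; its values are eigenvalues of matrices with
    natural entries ([loopval_integral]).

    The identity: the Hopf link is symmetric, [d X * h X Y = d Y * h Y X]
    ([hopf_sym]). Hence the right-hand side is
    [\sum_i d X_i ^ 2 * h X_i Y * h X_i (dual Y)]. By multiplicativity and the
    decomposition of [Y \ox dual Y] into simple objects [Z], and again by
    symmetry, it becomes the sum over these [Z] of
    [d Z * \sum_i d X_i * h Z X_i]. If the inner sum is not zero then [Z]
    centralizes every object ([killing]); since [Z] lies in [D], the hypothesis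
    forces [Z] to be the unit, which occurs once in [Y \ox dual Y] and
    contributes [\sum_i d X_i ^ 2].

    The killing property is the handle slide. Let [lam] be the inner sum.
    A loop around [Z] with a strand [W] pulled into it can be read in two ways.
    By the hexagons it gives [lam] times the double braiding of [Z] and [W].
    On the other hand, the tensor products of [W] with the [X_i] decompose into
    copies of the [X_k]; rotating the inclusions and projections of these copies
    gives dual bases of the spaces of maps between the [dual X_i] and
    [dual X_k \ox W] ([rot_dual_bases]), so the weighted sum of all loops also
    equals [lam] times the identity.

    If [d Y = 0] the quotient is [0] by convention; otherwise
    [d Y = d (Y \ox 1) = d Y * d 1] gives [d 1 = 1].

    All these pictures are drawn in the left regular action of the category on
    itself: a morphism is replaced by the family of its tensor products with a
    spectator object [A] on the right, and a word [X Y Z] by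
    [A |-> X \ox (Y \ox (Z \ox A))]. Composition of such words is strictly
    associative, so after the basic caps, cups and crossings have been
    translated ([bend_rw], [swap_tensr], [swap_tensl]) no coherence argument is
    needed, and every step is naturality or a zigzag. *)

(** * Linear categories *)

Section Linear.
Context {K : fieldType} {C : linear_category K}.
Implicit Types X Y Z W : C.

Lemma compm0 {X Y Z} (g : Hom Y Z) : g \oc (0 : Hom X Y) = 0.
Proof. by have := comp_linearr g (-1) 0 (0 : Hom X Y); rewrite !scaleN1r oppr0 addr0 addNr. Qed.

Lemma comp0m {X Y Z} (f : Hom X Y) : (0 : Hom Y Z) \oc f = 0.
Proof. by have := comp_linearl f (-1) 0 (0 : Hom Y Z); rewrite !scaleN1r oppr0 addr0 addNr. Qed.

Lemma compmD {X Y Z} (g : Hom Y Z) (f f' : Hom X Y) :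
  g \oc (f + f') = (g \oc f) + (g \oc f').
Proof. by have := comp_linearr g 1 f f'; rewrite !scale1r. Qed.

Lemma compDm {X Y Z} (g g' : Hom Y Z) (f : Hom X Y) :
  (g + g') \oc f = (g \oc f) + (g' \oc f).
Proof. by have := comp_linearl f 1 g g'; rewrite !scale1r. Qed.

Lemma compmZ {X Y Z} (g : Hom Y Z) a (f : Hom X Y) :
  g \oc (a *: f) = a *: (g \oc f).
Proof. by have := comp_linearr g a f 0; rewrite compm0 !addr0. Qed.

Lemma compZm {X Y Z} a (g : Hom Y Z) (f : Hom X Y) :
  (a *: g) \oc f = a *: (g \oc f).
Proof. by have := comp_linearl f a g 0; rewrite comp0m !addr0. Qed.

Lemma compm_sum {X Y Z} I (r : seq I) (P : pred I) (g : Hom Y Z)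
    (F : I -> Hom X Y) :
  g \oc (\sum_(i <- r | P i) F i) = \sum_(i <- r | P i) (g \oc F i).
Proof. exact: (big_morph (compm g) (compmD g) (compm0 g)). Qed.

Lemma comp_summ {X Y Z} I (r : seq I) (P : pred I) (f : Hom X Y)
    (F : I -> Hom Y Z) :
  (\sum_(i <- r | P i) F i) \oc f = \sum_(i <- r | P i) (F i \oc f).
Proof.
exact: (big_morph (fun g => compm g f) (fun g h => compDm g h f) (comp0m f)).
Qed.

(** Chains of composites are kept nested to the right; these forms of an
    equation let it rewrite a segment that is followed by a tail [x]. *)
Lemma reassoc2 {X Y Z W} {g : Hom Y Z} {f : Hom X Y} {k : Hom X Z} :
  g \oc f = k -> forall x : Hom W X, g \oc (f \oc x) = k \oc x.
Proof. by move=> <- x; rewrite compmA. Qed.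

Lemma reassoc3 {X Y Z V W} {h : Hom Z V} {g : Hom Y Z} {f : Hom X Y} {k : Hom X V} :
  h \oc (g \oc f) = k -> forall x : Hom W X, h \oc (g \oc (f \oc x)) = k \oc x.
Proof. by move=> <- x; rewrite !compmA. Qed.

Lemma scalar_inj X (a b : K) : idm X <> 0 -> a *: idm X = b *: idm X -> a = b.
Proof.
move=> nz E; apply/eqP; rewrite -subr_eq0; apply/negPn/negP => ab; apply: nz.
by rewrite -[idm X]scale1r -(mulVf ab) -scalerA scalerBl E subrr scaler0.
Qed.

End Linear.

(** * The left regular action of a monoidal category *)

(** The two whiskerings: [lw] is the action of an object on a morphism, [rw] the
    action of a morphism on an object. *)
Definition lw (K : fieldType) (C : monoidal_category K) (X : C) (A B : C)
  (g : Hom A B) : Hom (X \ox A) (X \ox B) := idm X \om g.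

Definition rw (K : fieldType) (C : monoidal_category K) (X Y : C)
  (f : Hom X Y) (A : C) : Hom (X \ox A) (Y \ox A) := f \om idm A.
Notation "X \lw g" := (lw X g) (at level 40, left associativity).
Notation "f \rw A" := (rw f A) (at level 40, left associativity).

(** The module form of an evaluation and of a coevaluation. These are locked so
    that reassociating a chain does not look inside them. *)
HB.lock Definition cap (K : fieldType) (C : monoidal_category K) (X Y : C)
    (e : Hom (X \ox Y) (unit_ob C)) (A : C) : Hom (X \ox (Y \ox A)) A :=
  lunit A \oc ((e \rw A) \oc assocV X Y A).

HB.lock Definition cup (K : fieldType) (C : monoidal_category K) (X Y : C)
    (c : Hom (unit_ob C) (X \ox Y)) (A : C) : Hom A (X \ox (Y \ox A)) :=
  assoc X Y A \oc ((c \rw A) \oc lunitV A).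

Arguments cap {K C X Y} e A.
Arguments cup {K C X Y} c A.

Section Action.
Context {K : fieldType} {C : monoidal_category K}.
Implicit Types X Y Z W A B D : C.
Local Notation I := (unit_ob C).

Lemma lw1 {X A} : X \lw idm A = idm (X \ox A).
Proof. exact: tensm1. Qed.

Lemma rw1 {X A} : idm X \rw A = idm (X \ox A).
Proof. exact: tensm1. Qed.

Lemma lw_comp {X A B D} {g : Hom B D} {f : Hom A B} :
  X \lw (g \oc f) = (X \lw g) \oc (X \lw f).
Proof. by rewrite /lw -tensm_comp compm1. Qed.

Lemma rw_comp {X Y Z A} {g : Hom Y Z} {f : Hom X Y} :
  (g \oc f) \rw A = (g \rw A) \oc (f \rw A).
Proof. by rewrite /rw -tensm_comp compm1. Qed.

Lemma lw_eq {X A B D} {g : Hom B D} {f : Hom A B} {k : Hom A D} :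
  g \oc f = k -> (X \lw g) \oc (X \lw f) = X \lw k.
Proof. by rewrite -lw_comp => ->. Qed.

Lemma rw_eq {X Y Z A} {g : Hom Y Z} {f : Hom X Y} {k : Hom X Z} :
  g \oc f = k -> (g \rw A) \oc (f \rw A) = k \rw A.
Proof. by rewrite -rw_comp => ->. Qed.

Lemma lwK {X A B} {g : Hom B A} {f : Hom A B} :
  g \oc f = idm A -> (X \lw g) \oc (X \lw f) = idm _.
Proof. by rewrite -lw_comp => ->; rewrite lw1. Qed.

Lemma rwK {X Y A} {g : Hom Y X} {f : Hom X Y} :
  g \oc f = idm X -> (g \rw A) \oc (f \rw A) = idm _.
Proof. by rewrite -rw_comp => ->; rewrite rw1. Qed.

Lemma rw_lw {X Y A B} {f : Hom X Y} {g : Hom A B} :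
  (f \rw B) \oc (X \lw g) = (Y \lw g) \oc (f \rw A).
Proof. by rewrite /lw /rw -!tensm_comp !compm1 !comp1m. Qed.

Lemma tensmE {X Y A B} {f : Hom X Y} {g : Hom A B} :
  f \om g = (f \rw B) \oc (X \lw g).
Proof. by rewrite /lw /rw -!tensm_comp !compm1 !comp1m. Qed.

Lemma lwD X A B (f g : Hom A B) : X \lw (f + g) = X \lw f + X \lw g.
Proof. by have := tensm_linearr (idm X) 1 f g; rewrite !scale1r. Qed.

Lemma lw0 X A B : X \lw (0 : Hom A B) = 0.
Proof.
by have := tensm_linearr (idm X) (-1) 0 (0 : Hom A B);
   rewrite !scaleN1r oppr0 addr0 addNr.
Qed.

Lemma lwZ X A B a (f : Hom A B) : X \lw (a *: f) = a *: (X \lw f).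
Proof.
by have := tensm_linearr (idm X) a f 0; rewrite -/(lw X _) -/(lw X 0) lw0 !addr0.
Qed.

Lemma lw_sum X A B J (r : seq J) (P : pred J) (F : J -> Hom A B) :
  X \lw (\sum_(i <- r | P i) F i) = \sum_(i <- r | P i) (X \lw F i).
Proof. exact: (big_morph (@lw K C X A B) (@lwD X A B) (lw0 X A B)). Qed.

Lemma rwD X Y A (f g : Hom X Y) : (f + g) \rw A = f \rw A + g \rw A.
Proof. by have := tensm_linearl (idm A) 1 f g; rewrite !scale1r. Qed.

Lemma rw0 X Y A : (0 : Hom X Y) \rw A = 0.
Proof.
by have := tensm_linearl (idm A) (-1) 0 (0 : Hom X Y);
   rewrite !scaleN1r oppr0 addr0 addNr.
Qed.

Lemma rwZ X Y A a (f : Hom X Y) : (a *: f) \rw A = a *: (f \rw A).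
Proof.
by have := tensm_linearl (idm A) a f 0; rewrite -/(rw _ A) -/(rw 0 A) rw0 !addr0.
Qed.

Lemma rw_sum X Y A J (r : seq J) (P : pred J) (F : J -> Hom X Y) :
  (\sum_(i <- r | P i) F i) \rw A = \sum_(i <- r | P i) (F i \rw A).
Proof.
exact: (big_morph (fun f : Hom X Y => rw f A) (@rwD X Y A) (rw0 X Y A)).
Qed.

Lemma assoc_lw {X Y A B} {f : Hom A B} :
  assoc X Y B \oc ((X \ox Y) \lw f) = (X \lw (Y \lw f)) \oc assoc X Y A.
Proof. by rewrite /lw -assoc_natural tensm1. Qed.

Lemma assocV_lw {X Y A B} {f : Hom A B} :
  assocV X Y B \oc (X \lw (Y \lw f)) = ((X \ox Y) \lw f) \oc assocV X Y A.
Proof.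
rewrite -[LHS]compm1 -(assocVK X Y A) -!compmA (compmA _ _ (assocV _ _ _)).
by rewrite -assoc_lw -!compmA (reassoc2 (assocK _ _ _)) comp1m.
Qed.

Lemma assoc_rw {X Y Z A} {f : Hom X Y} :
  assoc Y Z A \oc ((f \rw Z) \rw A) = (f \rw (Z \ox A)) \oc assoc X Z A.
Proof. by rewrite /rw assoc_natural tensm1. Qed.

Lemma assocV_rw {X Y Z A} {f : Hom X Y} :
  assocV Y Z A \oc (f \rw (Z \ox A)) = ((f \rw Z) \rw A) \oc assocV X Z A.
Proof.
rewrite -[LHS]compm1 -(assocVK X Z A) -!compmA (compmA _ _ (assocV _ _ _)).
by rewrite -assoc_rw -!compmA (reassoc2 (assocK _ _ _)) comp1m.
Qed.

Lemma assoc_mid {X Y Z A} {f : Hom Y Z} :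
  assoc X Z A \oc ((X \lw f) \rw A) = (X \lw (f \rw A)) \oc assoc X Y A.
Proof. by rewrite /rw /lw assoc_natural. Qed.

Lemma assocV_mid {X Y Z A} {f : Hom Y Z} :
  assocV X Z A \oc (X \lw (f \rw A)) = ((X \lw f) \rw A) \oc assocV X Y A.
Proof.
rewrite -[LHS]compm1 -(assocVK X Y A) -!compmA (compmA _ _ (assocV _ _ _)).
by rewrite -assoc_mid -!compmA (reassoc2 (assocK _ _ _)) comp1m.
Qed.

Lemma lunit_lw {A B} {f : Hom A B} : lunit B \oc (I \lw f) = f \oc lunit A.
Proof. exact: lunit_natural. Qed.

Lemma lunitV_lw {A B} {f : Hom A B} : lunitV B \oc f = (I \lw f) \oc lunitV A.
Proof.
rewrite -[LHS]compm1 -(lunitVK A) -!compmA (compmA _ _ (lunitV _)) -lunit_lw -!compmA.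
by rewrite (reassoc2 (lunitK _)) comp1m.
Qed.

Lemma runit_rw {A B} {f : Hom A B} : runit B \oc (f \rw I) = f \oc runit A.
Proof. exact: runit_natural. Qed.

Lemma lw_inj A B (f g : Hom A B) : I \lw f = I \lw g -> f = g.
Proof.
move=> E; rewrite -[f]compm1 -[g]compm1 -(lunitVK A) !compmA -!lunit_lw.
by rewrite E.
Qed.

Lemma rw_inj A B (f g : Hom A B) : f \rw I = g \rw I -> f = g.
Proof.
move=> E; rewrite -[f]compm1 -[g]compm1 -(runitVK A) !compmA -!runit_rw.
by rewrite E.
Qed.

Lemma epi_assoc X Y Z B (f g : Hom (X \ox (Y \ox Z)) B) :
  f \oc assoc X Y Z = g \oc assoc X Y Z -> f = g.
Proof.
by move=> E; rewrite -[f]compm1 -[g]compm1 -(assocVK X Y Z) !compmA E.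
Qed.

Lemma pentagonR {W X Y Z} :
  assoc W X (Y \ox Z) \oc assoc (W \ox X) Y Z =
  (W \lw assoc X Y Z) \oc (assoc W (X \ox Y) Z \oc (assoc W X Y \rw Z)).
Proof. by rewrite pentagon -!compmA. Qed.

Lemma runit_assoc {X A} : (X \lw lunit A) \oc assoc X I A = runit X \rw A.
Proof. exact: triangle. Qed.

(** Kelly's coherence law: the unitor of a tensor product acts on the first
    factor only. It suffices to check it after tensoring with the unit, where
    the pentagon and two triangles give it. *)
Lemma lunit_assoc {X A} : lunit (X \ox A) \oc assoc I X A = lunit X \rw A.
Proof.
apply: lw_inj; apply: epi_assoc.
rewrite -assoc_mid.
have cancel (f g : Hom ((I \ox (I \ox X)) \ox A) (I \ox (X \ox A))) :
    f \oc (assoc I I X \rw A) = g \oc (assoc I I X \rw A) -> f = g.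
  move=> E; rewrite -[f]compm1 -[g]compm1 -rw1 -(assocVK I I X) rw_comp.
  by rewrite !compmA E.
apply: cancel; rewrite -!compmA -rw_comp runit_assoc lw_comp -!compmA.
by rewrite -pentagonR (reassoc2 runit_assoc) assoc_rw.
Qed.

Lemma lunitV_assoc {X A} : assoc I X A \oc (lunitV X \rw A) = lunitV (X \ox A).
Proof.
rewrite -[RHS]compm1 -rw1 -(lunitVK X) rw_comp -lunit_assoc.
by rewrite !compmA lunitK comp1m.
Qed.

Lemma runitV_assoc {X A} :
  assoc X I A \oc (runitV X \rw A) = X \lw lunitV A.
Proof.
rewrite -[LHS]comp1m -lw1 -(lunitK A) lw_comp -!compmA.
by rewrite (reassoc2 runit_assoc) (rwK (runitVK X)) compm1.
Qed.

Lemma cap_nat {X Y} {e : Hom (X \ox Y) I} {A B} {f : Hom A B} :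
  cap e B \oc (X \lw (Y \lw f)) = f \oc cap e A.
Proof.
by rewrite cap.unlock -!compmA assocV_lw (reassoc2 rw_lw) -!compmA (reassoc2 lunit_lw) -!compmA.
Qed.

Lemma cup_nat {X Y} {c : Hom I (X \ox Y)} {A B} {f : Hom A B} :
  cup c B \oc f = (X \lw (Y \lw f)) \oc cup c A.
Proof.
by rewrite cup.unlock -!compmA lunitV_lw (reassoc2 rw_lw) -!compmA (reassoc2 assoc_lw) -!compmA.
Qed.

Lemma cap_pre {X Y X' Y'} {e : Hom (X \ox Y) I} {f : Hom X' X} {g : Hom Y' Y} {A} :
  cap (e \oc (f \om g)) A = cap e A \oc ((f \rw (Y \ox A)) \oc (X' \lw (g \rw A))).
Proof.
rewrite cap.unlock tensmE !rw_comp -!compmA -assocV_mid.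
by rewrite (reassoc2 (esym assocV_rw)) -!compmA.
Qed.

Lemma cup_post {X Y X' Y'} {c : Hom I (X \ox Y)} {f : Hom X X'} {g : Hom Y Y'} {A} :
  cup ((f \om g) \oc c) A =
  (f \rw (Y' \ox A)) \oc ((X \lw (g \rw A)) \oc cup c A).
Proof.
rewrite cup.unlock tensmE !rw_comp -!compmA (reassoc2 assoc_rw) -!compmA (reassoc2 assoc_mid).
by rewrite -!compmA.
Qed.

Lemma cup_inj X Y (c c' : Hom I (X \ox Y)) : cup c I = cup c' I -> c = c'.
Proof.
have cupE u : u \rw I = assocV X Y I \oc (cup u I \oc lunit I).
  by rewrite cup.unlock -!compmA lunitK compm1 (reassoc2 (assocK _ _ _)) comp1m.
by move=> E; apply: rw_inj; rewrite !cupE E.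
Qed.

Lemma cup_cap {X Y} {e : Hom (X \ox Y) I} {c : Hom I (X \ox Y)} {a} {A} :
  e \oc c = a *: idm I -> cap e A \oc cup c A = a *: idm A.
Proof.
move=> E; rewrite cap.unlock cup.unlock -!compmA (reassoc2 (assocK _ _ _)) comp1m.
by rewrite (reassoc2 (esym rw_comp)) E rwZ rw1 compZm compmZ comp1m lunitVK.
Qed.

(** The associators in [bend] are exactly those that the strict picture hides:
    the pentagon, the triangle and Kelly's law absorb them all. *)
Lemma bend_rw {A B A'} {e : Hom (A \ox B) I} {c : Hom I (B \ox A')} {D} :
  bend e c \rw D = cap e (A' \ox D) \oc (A \lw cup c D).
Proof.
rewrite /bend cap.unlock cup.unlock !rw_comp -/(lw _ _) -/(rw _ _) !lw_comp -!compmA.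
rewrite -runitV_assoc (reassoc2 (esym assoc_mid)) -!compmA.
rewrite -[(assocV A B A' \rw D)]comp1m -(assocK (A \ox B) A' D).
have -> : A \lw assoc B A' D =
   assoc A B (A' \ox D) \oc (assoc (A \ox B) A' D
     \oc ((assocV A B A' \rw D) \oc assocV A (B \ox A') D)).
  rewrite (reassoc2 pentagonR) -!compmA (reassoc2 (rwK (assocVK _ _ _))) comp1m.
  by rewrite assocVK compm1.
rewrite -!compmA (reassoc2 (assocK A B _)) comp1m (reassoc2 (assocK A _ _)) comp1m.
rewrite (reassoc2 (esym assoc_rw)) -!compmA (reassoc2 lunit_assoc).
by rewrite (reassoc2 (assocK _ _ _)) comp1m.
Qed.

Lemma bendr_rw {A B A'} {e : Hom (B \ox A) I} {c : Hom I (A' \ox B)} {D} :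
  bendr e c \rw D = (A' \lw cap e D) \oc cup c (A \ox D).
Proof.
rewrite /bendr cap.unlock cup.unlock !rw_comp -/(lw _ _) -/(rw _ _) !lw_comp -!compmA.
rewrite -lunitV_assoc (reassoc2 (esym assoc_rw)) -!compmA.
rewrite -runit_assoc -!compmA (reassoc2 assoc_mid) -!compmA.
congr (_ \oc (_ \oc _)).
by rewrite (reassoc2 pentagonR) -!compmA (reassoc2 (lwK (assocK _ _ _))) comp1m.
Qed.

End Action.

(** * Duals *)

Section Pentagon.
Context {K : fieldType} {C : monoidal_category K}.
Implicit Types X Y Z W A B : C.
Local Notation I := (unit_ob C).

Lemma pentagon_rwV {X Y Z A} :
  assoc (X \ox Y) Z A \oc (assocV X Y Z \rw A) =
  assocV X Y (Z \ox A) \oc ((X \lw assoc Y Z A) \oc assoc X (Y \ox Z) A).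
Proof.
rewrite -[RHS]compm1 -rw1 -(assocVK X Y Z) rw_comp -!compmA.
by rewrite (reassoc3 (esym pentagonR)) -!compmA (reassoc2 (assocK _ _ _)) comp1m.
Qed.

Lemma pentagon_rw {X Y Z A} :
  (assoc X Y Z \rw A) \oc assocV (X \ox Y) Z A =
  assocV X (Y \ox Z) A \oc ((X \lw assocV Y Z A) \oc assoc X Y (Z \ox A)).
Proof.
rewrite -[RHS]compm1 -(assocVK (X \ox Y) Z A) -!compmA (reassoc2 pentagonR) -!compmA.
by rewrite (reassoc2 (lwK (assocK _ _ _))) comp1m (reassoc2 (assocK _ _ _)) comp1m.
Qed.

Lemma cap_rw {X Y Z A} {e : Hom (X \ox Y) I} :
  cap e Z \rw A = cap e (Z \ox A) \oc ((X \lw assoc Y Z A) \oc assoc X (Y \ox Z) A).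
Proof.
rewrite cap.unlock !rw_comp -!compmA -lunit_assoc -!compmA (reassoc2 assoc_rw) -!compmA.
by rewrite pentagon_rwV.
Qed.

Lemma cap_assoc {X Y Z A} {e : Hom (X \ox (Y \ox Z)) I} :
  cap (e \oc assoc X Y Z) A =
  cap e A \oc ((X \lw assocV Y Z A) \oc assoc X Y (Z \ox A)).
Proof. by rewrite cap.unlock rw_comp -!compmA pentagon_rw. Qed.

Lemma cap_lw {X Y Y' A} {e : Hom (X \ox Y) I} {g : Hom Y' Y} :
  cap (e \oc (X \lw g)) A = cap e A \oc (X \lw (g \rw A)).
Proof. by rewrite cap_pre -/(rw _ _) rw1 comp1m. Qed.

Lemma cap_rwl {X X' Y A} {e : Hom (X \ox Y) I} {f : Hom X' X} :
  cap (e \oc (f \rw Y)) A = cap e A \oc (f \rw (Y \ox A)).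
Proof. by rewrite cap_pre -/(rw _ _) rw1 lw1 compm1. Qed.

Lemma cup_lw {X Y Y' A} {c : Hom I (X \ox Y)} {g : Hom Y Y'} :
  cup ((X \lw g) \oc c) A = (X \lw (g \rw A)) \oc cup c A.
Proof. by rewrite cup_post rw1 comp1m. Qed.

Lemma cup_rwl {X X' Y A} {c : Hom I (X \ox Y)} {f : Hom X X'} :
  cup ((f \rw Y) \oc c) A = (f \rw (Y \ox A)) \oc cup c A.
Proof. by rewrite cup_post rw1 lw1 comp1m. Qed.

End Pentagon.

(** These exhibit [dual Y \ox dual X] as a dual of [X \ox Y]; it has to be
    compared with the chosen one, [dual (X \ox Y)]. *)
HB.lock Definition ev_nested (K : fieldType) (C : rigid_category K) (X Y A : C) :
    Hom ((dual Y \ox dual X) \ox ((X \ox Y) \ox A)) A :=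
  cap (ev Y) A \oc ((dual Y \lw cap (ev X) (Y \ox A)) \oc
    ((dual Y \lw (dual X \lw assoc X Y A)) \oc
       assoc (dual Y) (dual X) ((X \ox Y) \ox A))).

HB.lock Definition coev_nested (K : fieldType) (C : rigid_category K) (X Y A : C) :
    Hom A ((X \ox Y) \ox ((dual Y \ox dual X) \ox A)) :=
  assocV X Y _ \oc ((X \lw (Y \lw assocV (dual Y) (dual X) A)) \oc
    ((X \lw cup (coev Y) (dual X \ox A)) \oc cup (coev X) A)).

Arguments ev_nested {K C} X Y A.
Arguments coev_nested {K C} X Y A.

Section Rigid.
Context {K : fieldType} {C : rigid_category K}.
Implicit Types X Y Z W A B : C.
Local Notation I := (unit_ob C).

Lemma ev_zigzag {X A} : (X \lw cap (ev X) A) \oc cup (coev X) (X \ox A) = idm _.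
Proof. by rewrite -bendr_rw (left_dualP X).1 rw1. Qed.

Lemma ev_zigzag_dual {X A} :
  cap (ev X) (dual X \ox A) \oc (dual X \lw cup (coev X) A) = idm _.
Proof. by rewrite -bend_rw (left_dualP X).2 rw1. Qed.

Lemma dualm_rw {X Y} {f : Hom X Y} {A} :
  dualm f \rw A =
  cap (ev Y) (dual X \ox A) \oc
    (dual Y \lw ((f \rw (dual X \ox A)) \oc cup (coev X) A)).
Proof. by rewrite /dualm bend_rw cup_rwl. Qed.

Lemma coev_dualm {X Y} {f : Hom X Y} {A} :
  (f \rw (dual X \ox A)) \oc cup (coev X) A =
  (Y \lw (dualm f \rw A)) \oc cup (coev Y) A.
Proof.
rewrite dualm_rw lw_comp -!compmA -cup_nat.
by rewrite (reassoc2 ev_zigzag) comp1m.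
Qed.

Lemma ev_dualm {X Y} {f : Hom X Y} {A} :
  cap (ev Y) A \oc (dual Y \lw (f \rw A)) =
  cap (ev X) A \oc (dualm f \rw (X \ox A)).
Proof.
rewrite dualm_rw lw_comp (reassoc2 (esym cap_nat)) -!compmA.
by rewrite -!lw_comp (reassoc2 (esym rw_lw)) -!compmA ev_zigzag compm1.
Qed.

(** Duality is full: a morphism between duals is bent back by the same
    evaluations. *)
Lemma dualmP X Y (f : Hom (dual Y) (dual X)) : exists g : Hom X Y, f = dualm g.
Proof.
exists (bendr (ev X) ((Y \lw f) \oc coev Y)); apply: rw_inj.
rewrite dualm_rw bendr_rw cup_lw -!compmA.
rewrite cup_nat (reassoc2 (lw_eq rw_lw)) !lw_comp -!compmA.
by rewrite (reassoc2 (lwK (lwK ev_zigzag_dual))) comp1m (reassoc2 cap_nat) -!compmA ev_zigzag_dual compm1.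
Qed.

Lemma dualmD X Y (f g : Hom X Y) : dualm (f + g) = dualm f + dualm g.
Proof.
by apply: rw_inj; rewrite rwD !dualm_rw rwD compDm lwD compmD.
Qed.

Lemma dualmZ X Y a (f : Hom X Y) : dualm (a *: f) = a *: dualm f.
Proof.
by apply: rw_inj; rewrite rwZ !dualm_rw rwZ compZm lwZ compmZ.
Qed.

Lemma dualm0 X Y : dualm (0 : Hom X Y) = 0.
Proof. by rewrite -(scale0r 0) dualmZ scale0r. Qed.

Lemma dualm_sum X Y J (r : seq J) (P : pred J) (F : J -> Hom X Y) :
  dualm (\sum_(i <- r | P i) F i) = \sum_(i <- r | P i) dualm (F i).
Proof. exact: (big_morph (@dualm K C X Y) (@dualmD X Y) (dualm0 X Y)). Qed.

Lemma dualm1 X : dualm (idm X) = idm (dual X).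
Proof. by apply: rw_inj; rewrite dualm_rw rw1 comp1m ev_zigzag_dual rw1. Qed.

Lemma dualm_comp X Y Z (g : Hom Y Z) (f : Hom X Y) :
  dualm (g \oc f) = dualm f \oc dualm g.
Proof.
apply: rw_inj; rewrite rw_comp [LHS]dualm_rw rw_comp -!compmA.
rewrite coev_dualm (reassoc2 rw_lw) -!compmA lw_comp (reassoc2 cap_nat) -!compmA.
by rewrite [dualm g \rw _]dualm_rw lw_comp.
Qed.

Lemma ev_nested_nat {X Y A B} {f : Hom A B} :
  ev_nested X Y B \oc (_ \lw (_ \lw f)) = f \oc ev_nested X Y A.
Proof.
rewrite ev_nested.unlock -!compmA assoc_lw (reassoc2 (lw_eq (lw_eq assoc_lw))) !lw_comp.
by rewrite -!compmA (reassoc2 (lw_eq cap_nat)) lw_comp -!compmA (reassoc2 cap_nat) -!compmA.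
Qed.

Lemma coev_nested_nat {X Y A B} {f : Hom A B} :
  coev_nested X Y B \oc f = (_ \lw (_ \lw f)) \oc coev_nested X Y A.
Proof.
rewrite coev_nested.unlock -!compmA cup_nat (reassoc2 (lw_eq cup_nat)) lw_comp -!compmA.
by rewrite (reassoc2 (lw_eq (lw_eq assocV_lw))) !lw_comp -!compmA (reassoc2 assocV_lw) -!compmA.
Qed.

Lemma ev_nestedK {X Y A} :
  ((X \ox Y) \lw ev_nested X Y A) \oc coev_nested X Y ((X \ox Y) \ox A) = idm _.
Proof.
rewrite ev_nested.unlock coev_nested.unlock (reassoc2 (esym assocV_lw)) -!compmA.
rewrite !lw_comp -!compmA (reassoc2 (lwK (lwK (assocVK _ _ _)))) comp1m.
rewrite (reassoc2 (lw_eq (esym cup_nat))) lw_comp -!compmA.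
rewrite (reassoc2 (lw_eq (esym cup_nat))) lw_comp -!compmA.
rewrite (reassoc2 (lwK ev_zigzag)) comp1m -cup_nat (reassoc2 ev_zigzag) comp1m.
by rewrite assocK.
Qed.

Lemma ev_tens_rw {X Y A} : cap (ev_tens X Y) A = ev_nested X Y A.
Proof.
rewrite ev_nested.unlock.
have -> : ev_tens X Y =
    (ev Y \oc (dual Y \lw cap (ev X) Y)) \oc assoc (dual Y) (dual X) (X \ox Y).
  by rewrite /ev_tens cap.unlock !lw_comp -!compmA.
rewrite cap_assoc cap_lw cap_rw !lw_comp -!compmA.
by rewrite (reassoc2 (lwK (assocVK _ _ _))) comp1m.
Qed.

Lemma dual_tens_rw {X Y A} :
  dual_tens X Y \rw A =
  ev_nested X Y (dual (X \ox Y) \ox A) \oc (_ \lw cup (coev (X \ox Y)) A).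
Proof. by rewrite /dual_tens bend_rw ev_tens_rw. Qed.

(** The map [dual_tens] is a bend, so a zigzag identity for either of the two
    duals of [X \ox Y] removes it. *)
Lemma ev_dual_tens {X Y A} :
  cap (ev (X \ox Y)) A \oc (dual_tens X Y \rw ((X \ox Y) \ox A)) = ev_nested X Y A.
Proof.
by rewrite dual_tens_rw (reassoc2 (esym ev_nested_nat)) -!compmA (lwK ev_zigzag) compm1.
Qed.

Lemma coev_dual_tens {X Y A} :
  cup (coev (X \ox Y)) A =
  ((X \ox Y) \lw (dual_tens X Y \rw A)) \oc coev_nested X Y A.
Proof.
by rewrite dual_tens_rw lw_comp -!compmA -coev_nested_nat (reassoc2 ev_nestedK) comp1m.
Qed.

End Rigid.

(** * Pivotal structures *)

Section Pivotal.
Context {K : fieldType} {C : rigid_category K} {j : pivotal_structure C}.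
Implicit Types X Y Z W A B : C.
Local Notation I := (unit_ob C).

Definition pivV X : Hom (dual (dual X)) X := projT1 (cid (pivotal_iso j X)).

Lemma pivK X : pivV X \oc j X = idm X.
Proof. by rewrite /pivV; case: cid => g []. Qed.

Lemma pivVK X : j X \oc pivV X = idm _.
Proof. by rewrite /pivV; case: cid => g []. Qed.

(** With [coevr], this makes [dual X] a right dual of [X] as well. *)
Definition evr X : Hom (X \ox dual X) I := ev (dual X) \oc (j X \rw dual X).

Definition coevr X : Hom I (dual X \ox X) :=
  (dual X \lw pivV X) \oc coev (dual X).

Lemma evr_rw {X A} :
  cap (evr X) A = cap (ev (dual X)) A \oc (j X \rw (dual X \ox A)).
Proof. exact: cap_rwl. Qed.

Lemma coevr_rw {X A} :
  cup (coevr X) A = (dual X \lw (pivV X \rw A)) \oc cup (coev (dual X)) A.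
Proof. exact: cup_lw. Qed.

Lemma evr_zigzag_dual {X A} :
  (dual X \lw cap (evr X) A) \oc cup (coevr X) (dual X \ox A) = idm _.
Proof.
rewrite evr_rw coevr_rw lw_comp -!compmA.
by rewrite (reassoc2 (lwK (rwK (pivVK X)))) comp1m ev_zigzag.
Qed.

Lemma evr_zigzag {X A} :
  cap (evr X) (X \ox A) \oc (X \lw cup (coevr X) A) = idm _.
Proof.
rewrite evr_rw coevr_rw lw_comp -!compmA (reassoc2 rw_lw) -!compmA (reassoc2 cap_nat).
by rewrite -!compmA rw_lw (reassoc2 ev_zigzag_dual) comp1m (rwK (pivK X)).
Qed.

Lemma evr_dualm {X Y} {f : Hom X Y} {A} :
  cap (evr Y) A \oc (f \rw (dual Y \ox A)) =
  cap (evr X) A \oc (X \lw (dualm f \rw A)).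
Proof.
rewrite !evr_rw -!compmA (rw_eq (pivotal_natural j f)) rw_lw rw_comp.
by rewrite (reassoc2 (esym ev_dualm)) -!compmA.
Qed.

(** Monoidality of the pivotal structure says that the right evaluations nest
    along the same map [dual_tens] as the left ones. *)
Lemma evr_dual_tens {X Y A} :
  cap (evr (X \ox Y)) A \oc ((X \ox Y) \lw (dual_tens X Y \rw A)) =
  cap (evr X) A \oc ((X \lw cap (evr Y) (dual X \ox A)) \oc
    ((X \lw (Y \lw assoc (dual Y) (dual X) A)) \oc
      assoc X Y ((dual Y \ox dual X) \ox A))).
Proof.
rewrite evr_rw -!compmA rw_lw (reassoc2 ev_dualm) -!compmA.
rewrite (rw_eq (pivotal_tens j X Y)) rw_comp (reassoc2 ev_dual_tens) ev_nested.unlock.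
rewrite tensmE rw_comp -!compmA (reassoc2 assoc_rw) -!compmA assoc_mid.
rewrite !evr_rw lw_comp -!compmA; congr (_ \oc _).
rewrite (reassoc2 (lw_eq rw_lw)) lw_comp -!compmA (reassoc2 rw_lw) -!compmA.
by do 3!rewrite (reassoc2 rw_lw) -!compmA.
Qed.

End Pivotal.

Arguments pivV {K C} j X.
Arguments evr {K C} j X.
Arguments coevr {K C} j X.

(** * Braidings *)

HB.lock Definition swap (K : fieldType) (C : braided_fusion_category K)
    (X Y A : C) : Hom (X \ox (Y \ox A)) (Y \ox (X \ox A)) :=
  assoc Y X A \oc ((braid X Y \rw A) \oc assocV X Y A).

Arguments swap {K C} X Y A.

HB.lock Definition dbraid (K : fieldType) (C : braided_fusion_category K)
    (Z X A : C) : Hom (Z \ox (X \ox A)) (Z \ox (X \ox A)) :=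
  swap X Z A \oc swap Z X A.

Arguments dbraid {K C} Z X A.

Section Braided.
Context {K : fieldType} {C : braided_fusion_category K}.
Implicit Types X Y Z W A B : C.
Local Notation I := (unit_ob C).

Lemma swap_nat {X Y A B} {f : Hom A B} :
  swap X Y B \oc (X \lw (Y \lw f)) = (Y \lw (X \lw f)) \oc swap X Y A.
Proof.
rewrite swap.unlock -!compmA assocV_lw (reassoc2 rw_lw) -!compmA (reassoc2 assoc_lw).
by rewrite -!compmA.
Qed.

Lemma braid_rw {X X' Y} {f : Hom X X'} :
  braid X' Y \oc (f \rw Y) = (Y \lw f) \oc braid X Y.
Proof. exact: braid_natural. Qed.

Lemma braid_lw {X Y Y'} {f : Hom Y Y'} :
  braid X Y' \oc (X \lw f) = (f \rw X) \oc braid X Y.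
Proof. exact: braid_natural. Qed.

Lemma swap_rw {X X' Y A} {f : Hom X X'} :
  swap X' Y A \oc (f \rw (Y \ox A)) = (Y \lw (f \rw A)) \oc swap X Y A.
Proof.
rewrite swap.unlock -!compmA assocV_rw (reassoc2 (rw_eq braid_rw)) rw_comp -!compmA.
by rewrite (reassoc2 assoc_mid) -!compmA.
Qed.

Lemma swap_lw {X Y Y' A} {f : Hom Y Y'} :
  swap X Y' A \oc (X \lw (f \rw A)) = (f \rw (X \ox A)) \oc swap X Y A.
Proof.
rewrite swap.unlock -!compmA assocV_mid (reassoc2 (rw_eq braid_lw)) rw_comp -!compmA.
by rewrite (reassoc2 assoc_rw) -!compmA.
Qed.

(** The two hexagons, in the strict picture: crossing a tensor product is
    crossing its factors one after the other. *)
Lemma swap_tensr {X Y Z A} :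
  assoc Y Z (X \ox A) \oc swap X (Y \ox Z) A =
  (Y \lw swap X Z A) \oc (swap X Y (Z \ox A) \oc (X \lw assoc Y Z A)).
Proof.
have hex : assoc Y Z X \oc braid X (Y \ox Z) =
    (Y \lw braid X Z) \oc (assoc Y X Z \oc ((braid X Y \rw Z) \oc assocV X Y Z)).
  by rewrite -[LHS]compm1 -(assocVK X Y Z) !compmA hexagon.
rewrite swap.unlock (reassoc2 pentagonR) -!compmA (reassoc2 (rw_eq hex)) !rw_comp -!compmA.
rewrite (reassoc2 assoc_mid) !lw_comp -!compmA; congr (_ \oc (_ \oc _)).
have -> : assocV X (Y \ox Z) A =
    (assoc X Y Z \rw A) \oc (assocV (X \ox Y) Z A
      \oc (assocV X Y (Z \ox A) \oc (X \lw assoc Y Z A))).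
  rewrite (reassoc2 pentagon_rw) -!compmA (reassoc2 (assocVK _ _ _)) comp1m.
  by rewrite (lwK (assocK _ _ _)) compm1.
rewrite (reassoc2 (rwK (assocK _ _ _))) comp1m.
rewrite (reassoc2 (esym assocV_rw)) -!compmA.
by rewrite (reassoc2 pentagon_rw) -!compmA (reassoc2 (assocVK _ _ _)) comp1m.
Qed.

Lemma swap_tensl {X Y Z A} :
  (Z \lw assoc X Y A) \oc swap (X \ox Y) Z A =
  swap X Z (Y \ox A) \oc ((X \lw swap Y Z A) \oc assoc X Y (Z \ox A)).
Proof.
have hex : braid (X \ox Y) Z =
    assoc Z X Y \oc ((braid X Z \rw Y) \oc (assocV X Z Y \oc
      ((X \lw braid Y Z) \oc assoc X Y Z))).
  have := hexagonV X Y Z => /(congr1 (fun u => assoc Z X Y \oc (u \oc assoc X Y Z))).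
  by rewrite -!compmA assocK compm1 (reassoc2 (assocVK _ _ _)) comp1m => ->.
rewrite swap.unlock hex !rw_comp -!compmA (reassoc3 (esym pentagonR)) -!compmA.
rewrite (reassoc2 assoc_rw) !lw_comp -!compmA; congr (_ \oc (_ \oc _)).
rewrite (reassoc2 pentagon_rwV) -!compmA; congr (_ \oc (_ \oc _)).
rewrite (reassoc2 assoc_mid) -!compmA; congr (_ \oc _).
by rewrite pentagon_rw (reassoc2 (assocVK _ _ _)) comp1m.
Qed.

Lemma swap_swap {Z X A} : swap X Z A \oc swap Z X A = dbraid Z X A.
Proof. by rewrite dbraid.unlock. Qed.

Lemma dbraid_nat {Z X A B} {f : Hom A B} :
  dbraid Z X B \oc (Z \lw (X \lw f)) = (Z \lw (X \lw f)) \oc dbraid Z X A.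
Proof.
by rewrite dbraid.unlock -!compmA swap_nat (reassoc2 swap_nat) -!compmA.
Qed.

Lemma dbraid_lw {Z X X' A} {f : Hom X X'} :
  dbraid Z X' A \oc (Z \lw (f \rw A)) = (Z \lw (f \rw A)) \oc dbraid Z X A.
Proof.
by rewrite dbraid.unlock -!compmA swap_lw (reassoc2 swap_rw) -!compmA.
Qed.

Lemma dbraid_tens {Z X Y A} :
  (Z \lw assoc X Y A) \oc dbraid Z (X \ox Y) A =
  swap X Z (Y \ox A) \oc ((X \lw dbraid Z Y A) \oc
    (swap Z X (Y \ox A) \oc (Z \lw assoc X Y A))).
Proof.
rewrite dbraid.unlock (reassoc2 swap_tensl) -!compmA swap_tensr lw_comp.
by rewrite -!compmA.
Qed.

Lemma dbraidE {Z X A} :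
  dbraid Z X A =
  assoc Z X A \oc (((braid X Z \oc braid Z X) \rw A) \oc assocV Z X A).
Proof.
by rewrite dbraid.unlock swap.unlock -!compmA (reassoc2 (assocK _ _ _)) comp1m
   rw_comp -!compmA.
Qed.

End Braided.

(** * Traces, dimensions and loops *)

Section UnitScalars.
Context {K : fieldType} {C : fusion_category K}.
Local Notation I := (unit_ob C).

Lemma idI_neq0 : idm I <> 0.
Proof.
move=> E; have [a [_ U]] := fusion_unit (idm I).
have := U 0; rewrite scale0r => /(_ E) a0.
have := U 1; rewrite scale1r => /(_ erefl); rewrite a0 => /esym/eqP.
by rewrite oner_eq0.
Qed.

Lemma idI_inj (a b : K) : a *: idm I = b *: idm I -> a = b.
Proof. exact: scalar_inj idI_neq0. Qed.

Lemma unit_scalarE (f : Hom I I) : f = unit_scalar f *: idm I.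
Proof. by rewrite /unit_scalar; case: cid => a []. Qed.

End UnitScalars.

Section Loops.
Context {K : fieldType} {C : braided_fusion_category K} {j : pivotal_structure C}.
Implicit Types X Y Z W A B : C.
Local Notation I := (unit_ob C).
Local Notation evr := (evr j).
Local Notation d := (pivotal_dim j).

Definition tr X (f : Hom X X) : K :=
  unit_scalar (evr X \oc ((f \rw dual X) \oc coev X)).

Lemma tr_rw {X} (f : Hom X X) {A} :
  cap (evr X) A \oc ((f \rw (dual X \ox A)) \oc cup (coev X) A) = tr f *: idm A.
Proof. by rewrite -cup_rwl (cup_cap (unit_scalarE _)). Qed.

Lemma dim_tr X : d X = tr (idm X).
Proof. by rewrite /tr rw1 comp1m /pivotal_dim. Qed.

Lemma dim_circle {X A} : cap (evr X) A \oc cup (coev X) A = d X *: idm A.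
Proof. by rewrite dim_tr -tr_rw rw1 comp1m. Qed.

Lemma trC X Y (f : Hom X Y) (g : Hom Y X) : tr (g \oc f) = tr (f \oc g).
Proof.
apply: (@idI_inj _ C); rewrite -!tr_rw !rw_comp -?compmA coev_dualm.
by rewrite (reassoc2 rw_lw) -?compmA (reassoc2 (esym evr_dualm)) -?compmA.
Qed.

(** Since both the coevaluation and the right evaluation of [X \ox Y] nest along
    [dual_tens], its trace can be taken one factor at a time. The endomorphism
    is given in strict form by [phi]. *)
Lemma tr_tens {X Y} {f : Hom (X \ox Y) (X \ox Y)}
    {phi : forall A, Hom (X \ox (Y \ox A)) (X \ox (Y \ox A))} :
  (forall A B (g : Hom A B),
     phi B \oc (X \lw (Y \lw g)) = (X \lw (Y \lw g)) \oc phi A) ->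
  (forall A, assoc X Y A \oc (f \rw A) = phi A \oc assoc X Y A) ->
  forall A, cap (evr X) A \oc ((X \lw cap (evr Y) (dual X \ox A)) \oc
    (phi _ \oc ((X \lw cup (coev Y) (dual X \ox A)) \oc cup (coev X) A)))
  = tr f *: idm A.
Proof.
move=> nat_phi phiE A; rewrite -tr_rw coev_dual_tens (reassoc2 rw_lw) -?compmA.
rewrite (reassoc2 evr_dual_tens) -?compmA (reassoc2 (phiE _)) -?compmA.
rewrite coev_nested.unlock (reassoc2 (assocVK _ _ _)) comp1m (reassoc2 (nat_phi _ _ _)) -?compmA.
by rewrite (reassoc2 (lwK (lwK (assocVK _ _ _)))) comp1m.
Qed.

Lemma dim_tens X Y : d (X \ox Y) = d X * d Y.
Proof.
apply: (@idI_inj _ C); rewrite dim_tr.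
rewrite -(tr_tens (phi := fun A => idm _)); last 2 first.
- by move=> *; rewrite comp1m compm1.
- by move=> *; rewrite rw1 comp1m compm1.
rewrite comp1m (reassoc2 (lw_eq dim_circle)) lwZ lw1 compZm comp1m compmZ dim_circle.
by rewrite scalerA mulrC.
Qed.

(** A loop coloured by [X] around the strand [Z]. *)
Definition loop Z X : Hom Z Z :=
  runit Z \oc ((Z \lw evr X) \oc (assoc Z X (dual X) \oc
    (((braid X Z \oc braid Z X) \rw dual X) \oc (assocV Z X (dual X) \oc
      ((Z \lw coev X) \oc runitV Z))))).

Lemma loop_rw {Z X A} :
  loop Z X \rw A =
  (Z \lw cap (evr X) A) \oc
    (dbraid Z X (dual X \ox A) \oc (Z \lw cup (coev X) A)).
Proof.
rewrite /loop !(@rw_comp _ _ Z).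
rewrite -runit_assoc -?compmA (reassoc2 assoc_mid) -?compmA.
rewrite cap.unlock cup.unlock !lw_comp -?compmA; congr (_ \oc (_ \oc _)).
rewrite -runitV_assoc (reassoc2 (esym assoc_mid)) -?compmA.
rewrite -[LHS]comp1m -(lwK (assocK X (dual X) A)) -?compmA.
rewrite (reassoc3 (esym pentagonR)) -?compmA; congr (_ \oc _).
rewrite dbraidE (reassoc2 assoc_rw) -?compmA; congr (_ \oc (_ \oc _)).
by rewrite (reassoc2 pentagon_rwV) -?compmA.
Qed.

(** A loop coloured by [X \ox Y] is a pair of nested loops; the inner one is a
    scalar and can be removed. *)
Lemma loop_tens Z X Y b :
  loop Z Y = b *: idm Z -> loop Z (X \ox Y) = b *: loop Z X.
Proof.
move=> loopY; apply: rw_inj; rewrite rwZ !loop_rw.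
rewrite coev_dual_tens lw_comp (reassoc2 dbraid_nat) -?compmA (reassoc2 (lw_eq evr_dual_tens)).
rewrite !lw_comp -?compmA (reassoc2 dbraid_tens) -?compmA coev_nested.unlock !lw_comp.
rewrite -?compmA (reassoc2 (lwK (assocVK _ _ _))) comp1m.
rewrite (reassoc2 swap_nat) -?compmA (reassoc2 (lw_eq dbraid_nat)) lw_comp -?compmA.
rewrite (reassoc2 swap_nat) -?compmA (reassoc2 (lwK (lwK (lwK (assocVK _ _ _))))) comp1m.
rewrite (reassoc2 swap_nat) -?compmA (reassoc2 (esym swap_nat)) -?compmA.
have E : (Z \lw cap (evr Y) (dual X \ox I)) \oc
    (dbraid Z Y (dual Y \ox (dual X \ox I)) \oc (Z \lw cup (coev Y) (dual X \ox I)))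
    = b *: idm _ by rewrite -loop_rw loopY rwZ rw1.
have {}E : (X \lw (Z \lw cap (evr Y) (dual X \ox I))) \oc
    ((X \lw dbraid Z Y (dual Y \ox (dual X \ox I))) \oc
     (X \lw (Z \lw cup (coev Y) (dual X \ox I)))) = b *: idm _.
  by rewrite -!lw_comp E lwZ lw1.
by rewrite (reassoc3 E) compZm comp1m !compmZ dbraid.unlock -?compmA.
Qed.

(** Morphisms slide around the loop: they pass the crossings by naturality, and
    the cap and the cup by duality. *)
Lemma loopC {Z X Y} {f : Hom X Y} {g : Hom Y X} {A} :
  (Z \lw cap (evr X) A) \oc ((Z \lw ((g \oc f) \rw (dual X \ox A))) \oc
    (dbraid Z X (dual X \ox A) \oc (Z \lw cup (coev X) A))) =
  (Z \lw cap (evr Y) A) \oc ((Z \lw ((f \oc g) \rw (dual Y \ox A))) \oc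
    (dbraid Z Y (dual Y \ox A) \oc (Z \lw cup (coev Y) A))).
Proof.
rewrite !rw_comp !lw_comp -?compmA (reassoc2 (lw_eq evr_dualm)) lw_comp -?compmA.
congr (_ \oc _).
rewrite (reassoc2 (lw_eq (esym rw_lw))) lw_comp -?compmA; congr (_ \oc _).
by rewrite (reassoc2 (esym dbraid_nat)) -?compmA (lw_eq (esym coev_dualm)) lw_comp
  (reassoc2 dbraid_lw) -?compmA.
Qed.

Lemma loop_sum Z V n (X : 'I_n -> C) (f : forall p, Hom (X p) V)
    (g : forall p, Hom V (X p)) :
  (forall p, g p \oc f p = idm (X p)) -> \sum_p (f p \oc g p) = idm V ->
  loop Z V = \sum_p loop Z (X p).
Proof.
move=> gf fg; apply: rw_inj; rewrite loop_rw rw_sum.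
rewrite -[dbraid _ _ _ \oc _]comp1m -lw1 -rw1 -fg rw_sum lw_sum.
rewrite comp_summ compm_sum; apply: eq_bigr => p _.
by rewrite loopC gf rw1 lw1 comp1m loop_rw.
Qed.

(** Both sides are the value of the Hopf link coloured by [X] and [Y]. *)
Lemma hopf_sym X Y a b : loop X Y = a *: idm X -> loop Y X = b *: idm Y ->
  d X * a = d Y * b.
Proof.
have hopf Z W c : loop Z W = c *: idm Z ->
    d Z * c = tr (braid W Z \oc braid Z W).
  move=> loopE; apply: (@idI_inj _ C).
  rewrite -(tr_tens (phi := fun A => dbraid Z W A)); last 2 first.
  - by move=> *; apply: dbraid_nat.
  - by move=> A; rewrite dbraidE -?compmA assocK compm1.
  have E : (Z \lw cap (evr W) (dual Z \ox I)) \oc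
    (dbraid Z W (dual W \ox (dual Z \ox I)) \oc (Z \lw cup (coev W) (dual Z \ox I)))
    = c *: idm _ by rewrite -loop_rw loopE rwZ rw1.
  by rewrite (reassoc3 E) compZm comp1m compmZ dim_circle scalerA mulrC.
by move=> /hopf -> /hopf ->; apply: trC.
Qed.

End Loops.

Arguments tr {K C} j {X} f.
Arguments loop {K C} j Z X.

(** * Simple objects and integrality *)

Section Schur.
Context {K : closedFieldType} {C : fusion_category K}.
Implicit Types X Y Z V : C.
Local Notation I := (unit_ob C).

Lemma zero_objectP X : idm X = 0 -> zero_object X.
Proof.
move=> X0 Y; split=> f; first by rewrite -[f]compm1 X0 compm0.
by rewrite -[f]comp1m X0 comp0m.
Qed.

Lemma simple_idm X : simple_object X -> idm X <> 0.
Proof. by case=> nz _ /zero_objectP. Qed.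

Lemma simple_iso X Y (f : Hom X Y) :
  simple_object X -> simple_object Y -> f <> 0 -> is_iso f.
Proof.
move=> [nzX sX] [_ sY] f0.
have [N [k [fk0 kU]]] := has_kernels (fusion_abelian C) f.
have mono_k : mono k.
  move=> Z g h E; have [|u [_ uU]] := kU Z (k \oc g); first by rewrite compmA fk0 comp0m.
  by rewrite -(uU g) // -(uU h).
have [N0|[k' [_ kk']]] := sX _ _ mono_k; last first.
  by case: f0; rewrite -[f]compm1 -kk' compmA fk0 comp0m.
have mono_f : mono f.
  move=> Z g h E; apply/eqP; rewrite -subr_eq0; apply/eqP.
  have [|u [<- _]] := kU Z (g - h).
    by rewrite compmD E -scaleN1r compmZ scaleN1r subrr.
  by rewrite (proj2 (N0 Z) u) compm0.
by have [zX|//] := sY _ _ mono_f; case: (nzX zX).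
Qed.

(** Over an algebraically closed field, composition with [f] has an eigenvector
    in [Hom X X]; subtracting the eigenvalue from [f] gives a non-invertible,
    hence zero, endomorphism. *)
Lemma schur X (f : Hom X X) : simple_object X -> exists a, f = a *: idm X.
Proof.
move=> sX; have nzX := simple_idm sX.
pose phi (v : 'rV[K]_(dim (Hom X X))) := v2r (f \oc r2v v).
have lin_phi : linear phi.
  by move=> a u v; rewrite /phi linearP compmD compmZ linearP.
pose Phi : {linear _ -> _} := HB.pack phi (GRing.isLinear.Build _ _ _ _ phi lin_phi).
pose M := lin1_mx Phi.
have [a ra] : exists a, root (char_poly M) a.
  apply/closed_rootP; rewrite size_char_poly eqSS.
  apply: contra_notN nzX => /eqP n0; rewrite -[idm X]v2rK.
  rewrite (_ : v2r (idm X) = 0) ?linear0 //.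
  by apply/rowP => i; have := ltn_ord i; rewrite {2}n0 ltn0.
exists a; apply: contrapT => fa.
have := ra; rewrite -eigenvalue_root_char => /eigenvalueP[v vM v0].
have fv : f \oc r2v v = a *: r2v v.
  by move: vM; rewrite mul_rV_lin1 /= /phi => /(congr1 r2v); rewrite v2rK linearZ.
have [g [gf _]] : is_iso (f - a *: idm X).
  by apply: simple_iso => // /eqP; rewrite subr_eq0 => /eqP.
case/eqP: v0; rewrite -[v]r2vK -[r2v v]comp1m -gf -compmA compDm fv.
by rewrite -scaleN1r scalerA mulN1r compZm comp1m scaleNr subrr compm0 linear0.
Qed.

Lemma irrP : simple_representatives (irr (C := C)).
Proof. exact: projT2 (cid (projT2 (cid (fusion_finite C)))). Qed.

Lemma irr_simple i : simple_object (irr i : C).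
Proof. by case: irrP. Qed.

Lemma irr_hom0 i i' (f : Hom (irr i : C) (irr i')) : i <> i' -> f = 0.
Proof.
move=> ii'; apply: contrapT => f0; apply: ii'; have [_ + _] := irrP; apply.
by exists f; apply: simple_iso => //; exact: irr_simple.
Qed.

(** Decompositions of [V] are indexed so that the inclusions and projections of
    the copies of [irr i] have source and target [irr i] on the nose: [f i p] is
    meaningful when [k p = i]. *)
Definition decomposition V n (k : 'I_n -> 'I_(fusion_rank C))
    (f : forall i, 'I_n -> Hom (irr i) V) (g : forall i, 'I_n -> Hom V (irr i)) :=
  [/\ forall p, g (k p) p \oc f (k p) p = idm (irr (k p)),
      forall i i' p q, k p = i -> k q = i' -> p <> q -> g i' q \oc f i p = 0
    & \sum_p (f (k p) p \oc g (k p) p) = idm V].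

Lemma decompositionP V : exists n k f g, @decomposition V n k f g.
Proof.
have [n [X [sX [inj [proj [projK proj0 injK]]]]]] := fusion_semisimple V.
have [_ _ cover] := irrP.
have [k isok] := choice (fun p => cover _ (sX p)).
have uv i p : {uv : Hom (irr i) (X p) * Hom (X p) (irr i) |
    k p = i -> uv.2 \oc uv.1 = idm _ /\ uv.1 \oc uv.2 = idm _}.
  case: (k p =P i) => [<-|ki]; last by exists (0, 0).
  have [v /cid[u [vu uv]]] := cid (isok p).
  by exists (u, v).
exists n, k, (fun i p => inj p \oc (sval (uv i p)).1),
  (fun i p => (sval (uv i p)).2 \oc proj p); split.
- move=> p; rewrite -compmA (reassoc2 (projK p)) comp1m.
  by have [] := svalP (uv (k p) p) erefl.
- move=> i i' p q _ _ /eqP pq.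
  by rewrite -compmA (reassoc2 (proj0 _ _ pq)) comp0m compm0.
- rewrite -injK; apply: eq_bigr => p _; rewrite -compmA.
  have [_ E] := svalP (uv (k p) p) erefl.
  by rewrite (reassoc2 E) comp1m.
Qed.

Lemma decomposition_sum V n k f g : @decomposition V n k f g ->
  is_direct_sum (fun p => irr (k p)) V.
Proof.
case=> gf gf0 fg; exists (fun p => f (k p) p), (fun p => g (k p) p); split=> //.
by move=> p q /eqP pq; apply: gf0.
Qed.

(** By Schur's lemma a map out of [irr i] only meets the copies of [irr i]. *)
Lemma decomposition_irr V n k f g i (h : Hom (irr i) V) :
  @decomposition V n k f g ->
  h = \sum_(p | k p == i) (f i p \oc (g i p \oc h)).
Proof.
case=> _ _ fg; rewrite -[LHS]comp1m -fg comp_summ [LHS](bigID (fun p => k p == i)) /=.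
rewrite [X in _ + X]big1 ?addr0 => [|p /eqP ki].
  by apply: eq_bigr => p /eqP E; subst i; rewrite compmA.
by rewrite -compmA (irr_hom0 (_ \oc h)) ?compm0 //; apply: nesym.
Qed.

(** For semisimple categories this is equivalent to simplicity, but unlike
    simplicity it passes to duals by a direct computation. *)
Definition schurian X := idm X <> 0 /\ forall f : Hom X X, exists a, f = a *: idm X.

Lemma simple_schurian X : simple_object X -> schurian X.
Proof. by move=> sX; split=> [|f]; [apply: simple_idm|apply: schur]. Qed.

Lemma schurian_irr X : schurian X -> exists i, isomorphic X (irr i).
Proof.
move=> [nz sc]; have [n [k [f [g [gf gf0 fg]]]]] := decompositionP X.
have [p fgp] : exists p, f (k p) p \oc g (k p) p <> 0.
  apply: contrapT => E; apply: nz; rewrite -fg big1 // => p _.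
  by apply: contrapT => Ep; apply: E; exists p.
exists (k p), (g (k p) p), (f (k p) p); split=> //.
have [a fa] := sc (f (k p) p \oc g (k p) p).
have a0 : a != 0 by apply: contra_notN fgp => /eqP a0; rewrite fa a0 scale0r.
(* [f g] is an idempotent scalar, and not zero, so it is the identity. *)
have : f (k p) p \oc g (k p) p \oc (f (k p) p \oc g (k p) p) =
  f (k p) p \oc g (k p) p by rewrite -compmA (reassoc2 (gf p)) comp1m.
rewrite fa compZm comp1m scalerA => /(scalar_inj nz)/eqP.
by rewrite -{3}[a]mulr1 (inj_eq (mulfI a0)) => /eqP ->; rewrite scale1r.
Qed.

Lemma unit_schurian : schurian I.
Proof.
split=> [|f]; first exact: idI_neq0.
by exists (unit_scalar f); apply: unit_scalarE.
Qed.

Lemma dual_schurian X : schurian X -> schurian (dual X).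
Proof.
case=> nz sc; split=> [X0|f]; last first.
  have [g ->] := dualmP f; have [a ->] := sc g.
  by exists a; rewrite dualmZ dualm1.
apply: nz; apply: rw_inj; rewrite rw0 rw1 -ev_zigzag.
by rewrite -[cup _ _]comp1m -lw1 -rw1 X0 rw0 lw0 comp0m compm0.
Qed.

Definition scal X (f : Hom X X) : K := xget 0 [set a | f = a *: idm X].

Lemma scalE X (f : Hom X X) : schurian X -> f = scal f *: idm X.
Proof. by case=> _ sc; rewrite /scal; case: xgetP => // E; have [a /E] := sc f. Qed.

End Schur.

(** The vector of the [h j] is a common eigenvector of the integer matrices
    [N i], with eigenvalues [h i]. *)
Lemma integral_fusion (K : fieldType) n (h : 'I_n -> K) (N : 'I_n -> 'I_n -> 'I_n -> nat) :
  (forall i j, h i * h j = \sum_k (N i j k)%:R * h k) ->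
  forall i, algebraic_integer (h i).
Proof.
move=> hN i; case: (pselect (exists j, h j != 0)) => [[j hj]|h0]; last first.
  suff -> : h i = 0 by apply: integral0.
  by apply/eqP/negPn/negP => hi; apply: h0; exists i.
pose M : 'M[int]_n := \matrix_(k, j) (N i j k : int).
exists (char_poly M); first exact: char_poly_monic.
rewrite map_char_poly -eigenvalue_root_char; apply/eigenvalueP.
exists (\row_j h j); last by apply: contra_neq hj => /rowP/(_ j); rewrite !mxE.
apply/rowP => k; rewrite !mxE hN; apply: eq_bigr => l _.
by rewrite !mxE mulrC.
Qed.

(** * Dimensions of duals *)

(** The unit need not be equal to its dual; these are the comparison maps. *)
HB.lock Definition counit (K : fieldType) (C : rigid_category K) (A : C) :
    Hom (dual (unit_ob C) \ox A) A :=
  cap (ev (unit_ob C)) A \oc (dual (unit_ob C) \lw lunitV A).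

HB.lock Definition counitV (K : fieldType) (C : rigid_category K) (A : C) :
    Hom A (dual (unit_ob C) \ox A) :=
  lunit _ \oc cup (coev (unit_ob C)) A.

Arguments counit {K C} A.
Arguments counitV {K C} A.

Section Counit.
Context {K : fieldType} {C : rigid_category K}.
Implicit Types A B : C.
Local Notation I := (unit_ob C).

Lemma counitVK {A} : counit A \oc counitV A = idm A.
Proof.
rewrite counit.unlock counitV.unlock -?compmA (reassoc2 (esym lunit_lw)) -?compmA.
rewrite -cup_nat (reassoc2 (esym lunit_lw)) -?compmA (reassoc2 ev_zigzag) comp1m.
exact: lunitVK.
Qed.

Lemma counitE {A} : cap (ev I) A \oc (dual I \lw lunitV A) = counit A.
Proof. by rewrite counit.unlock. Qed.

Lemma counit_nat {A B} {f : Hom A B} :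
  counit B \oc (dual I \lw f) = f \oc counit A.
Proof.
by rewrite counit.unlock -?compmA (lw_eq lunitV_lw) lw_comp (reassoc2 cap_nat) -?compmA.
Qed.

End Counit.

Section DualDim.
Context {K : fieldType} {C : braided_fusion_category K} {j : pivotal_structure C}.
Implicit Types X Y Z W A B : C.
Local Notation I := (unit_ob C).
Local Notation evr := (evr j).
Local Notation coevr := (coevr j).
Local Notation d := (pivotal_dim j).

Lemma ev_assocV {X Y A} (e : Hom (X \ox Y) I) :
  (e \rw A) \oc assocV X Y A = lunitV A \oc cap e A.
Proof. by rewrite cap.unlock (reassoc2 (lunitK _)) comp1m. Qed.

Lemma evr_coev {X A} :
  cap (evr X) (dual (dual X) \ox A) \oc (X \lw cup (coev (dual X)) A) = j X \rw A.
Proof. by rewrite evr_rw -?compmA rw_lw (reassoc2 ev_zigzag_dual) comp1m. Qed.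

(** Expanding the coevaluation of [dual X \ox X] into nested ones, a zigzag
    cancels [ev X] against the inner one, and the outer one remains. *)
Lemma dual_ev {X A} :
  dualm (ev X) \rw A =
  (dual_tens (dual X) X \rw A) \oc
    (assocV _ _ A \oc (cup (coev (dual X)) A \oc counit A)).
Proof.
rewrite dualm_rw coev_dual_tens (reassoc2 rw_lw) -?compmA coev_nested.unlock.
rewrite (reassoc2 (ev_assocV _)) -?compmA (reassoc2 cap_nat) -?compmA (reassoc2 ev_zigzag_dual) comp1m.
rewrite (reassoc2 (lunitV_lw)) -?compmA (reassoc2 (esym lunitV_lw)) -?compmA.
rewrite lw_comp (reassoc2 cap_nat) -?compmA; congr (_ \oc _).
by rewrite lw_comp (reassoc2 counitE) counit_nat -?compmA.
Qed.

(** The pivotal structure identifies [X] with its double dual compatibly with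
    evaluations. This is naturality of the right evaluation along the morphism
    [ev X] from [dual X \ox X] to the unit; the factor [d I] comes from closing
    up the unit strand. *)
Lemma ev_double_dual {X A} :
  d I *: cap (ev X) A = cap (evr (dual X)) A \oc (dual X \lw (j X \rw A)).
Proof.
have := evr_dualm (j := j) (f := ev X) (A := A).
rewrite dual_ev lw_comp (reassoc2 evr_dual_tens) -?compmA.
move=> /(congr1 (fun u => u \oc (assocV _ _ _ \oc (_ \lw (_ \lw counitV A))))).
rewrite -?compmA (reassoc2 (ev_assocV _)) -?compmA cap_nat.
have absorb : assocV (dual X) (dual (dual X)) A \oc
    (cup (coev (dual X)) A \oc counit A) \oc counitV A =
    assocV (dual X) (dual (dual X)) A \oc cup (coev (dual X)) A.
  by rewrite -!compmA counitVK compm1.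
rewrite assocV_lw (reassoc2 (lw_eq absorb)) (reassoc2 assoc_lw) -?compmA assocVK compm1.
have {}absorb := reassoc2 (assocVK (dual X) (dual (dual X)) A) (cup (coev (dual X)) A).
rewrite (lw_eq (lw_eq absorb)) comp1m (lw_eq evr_coev) => <-.
rewrite counitV.unlock -?compmA (reassoc2 (lunitK _)) comp1m (reassoc2 dim_circle) compZm.
by rewrite comp1m.
Qed.

(** The left circle coloured by [X] has value [d (dual X)]: this is where
    sphericality will be used, to replace it by [d X]. *)
Lemma dim_dual_circle {X A} : d I = 1 ->
  cap (ev X) A \oc cup (coevr X) A = d (dual X) *: idm A.
Proof.
move=> dI; have := ev_double_dual (X := X) (A := A); rewrite dI scale1r => ->.
rewrite coevr_rw -?compmA (reassoc2 (lwK (rwK (pivVK _)))) comp1m.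
exact: dim_circle.
Qed.

End DualDim.

(** * The killing property *)

Section CupAssoc.
Context {K : fieldType} {C : monoidal_category K}.
Implicit Types X Y Z W A B : C.
Local Notation I := (unit_ob C).

Lemma cup_assocV {X Y Z A} {c : Hom I (X \ox (Y \ox Z))} :
  cup (assocV X Y Z \oc c) A =
  assocV X Y (Z \ox A) \oc ((X \lw assoc Y Z A) \oc cup c A).
Proof. by rewrite cup.unlock rw_comp -!compmA (reassoc2 pentagon_rwV) -!compmA. Qed.

Lemma cup_assoc {X Y Z A} {c : Hom I ((X \ox Y) \ox Z)} :
  cup (assoc X Y Z \oc c) A =
  (X \lw assocV Y Z A) \oc (assoc X Y (Z \ox A) \oc cup c A).
Proof.
rewrite cup.unlock rw_comp -?compmA (reassoc2 pentagonR) -?compmA.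
by rewrite (reassoc2 (lwK (assocK _ _ _))) comp1m.
Qed.

End CupAssoc.

Section Rotation.
Context {K : fieldType} {C : braided_fusion_category K} {j : pivotal_structure C}.
Implicit Types P X Y Z W A B : C.
Local Notation I := (unit_ob C).
Local Notation evr := (evr j).
Local Notation coevr := (coevr j).

(** The projections and inclusions that occur when [W \ox X] is decomposed, with
    [P] and [X] moved to the other side. *)
Definition rot_out {P W X} (b : Hom (W \ox X) P) : Hom (dual P \ox W) (dual X) :=
  bend (ev P \oc (dual P \lw b) \oc assoc (dual P) W X) (coev X).

Definition rot_in {P W X} (a : Hom P (W \ox X)) : Hom (dual X) (dual P \ox W) :=
  bendr (evr X) (assocV (dual P) W X \oc ((dual P \lw a) \oc coevr P)).

Definition unrot {P W X} (s : Hom (dual X) (dual P \ox W)) : Hom P (W \ox X) :=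
  bend (evr P) (assoc (dual P) W X \oc ((s \rw X) \oc coevr X)).

(** Bending [X] alone gives what remains on either side of a loop coloured by [P]
    when a loop coloured by [W \ox X] is cut along a projection to [P]. *)
Definition half_out {P W X} (b : Hom (W \ox X) P) A :
    Hom (W \ox A) (P \ox (dual X \ox A)) :=
  (b \rw (dual X \ox A)) \oc (assocV W X _ \oc (W \lw cup (coev X) A)).

Definition half_in {P W X} (a : Hom P (W \ox X)) A :
    Hom (P \ox (dual X \ox A)) (W \ox A) :=
  (W \lw cap (evr X) A) \oc (assoc W X _ \oc (a \rw (dual X \ox A))).

Lemma rot_out_rw {P W X} {b : Hom (W \ox X) P} {A} :
  rot_out b \rw A =
  cap (ev P) (dual X \ox A) \oc ((dual P \lw half_out b A) \oc assoc (dual P) W A).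
Proof.
rewrite /rot_out bend_rw cap_assoc cap_lw /half_out !lw_comp -!compmA.
by rewrite assoc_lw.
Qed.

Lemma rot_in_rw {P W X} {a : Hom P (W \ox X)} {A} :
  rot_in a \rw A =
  assocV (dual P) W A \oc
    ((dual P \lw half_in a A) \oc cup (coevr P) (dual X \ox A)).
Proof.
rewrite /rot_in bendr_rw cup_assocV cup_lw /half_in !lw_comp -!compmA.
by rewrite (reassoc2 assocV_lw) -!compmA.
Qed.

Lemma half_out_rot {P W X} {b : Hom (W \ox X) P} {A} :
  half_out b A = (P \lw ((rot_out b \rw A) \oc assocV (dual P) W A)) \oc
    cup (coev P) (W \ox A).
Proof.
rewrite rot_out_rw -?compmA assocVK compm1 lw_comp -!compmA -cup_nat.
by rewrite (reassoc2 ev_zigzag) comp1m.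
Qed.

Lemma half_in_rot {P W X} {a : Hom P (W \ox X)} {A} :
  half_in a A = cap (evr P) (W \ox A) \oc
    (P \lw (assoc (dual P) W A \oc (rot_in a \rw A))).
Proof.
rewrite rot_in_rw (reassoc2 (assocVK _ _ _)) comp1m lw_comp (reassoc2 cap_nat) -!compmA.
by rewrite evr_zigzag compm1.
Qed.

Lemma half_in_unrot {P W X} {s : Hom (dual X) (dual P \ox W)} {A} :
  half_in (unrot s) A = cap (evr P) (W \ox A) \oc
    (P \lw (assoc (dual P) W A \oc (s \rw A))).
Proof.
rewrite /half_in /unrot bend_rw cup_assoc cup_rwl.
rewrite (reassoc2 (esym cap_nat)) -?compmA (reassoc2 (esym cap_nat)) -?compmA.
congr (_ \oc _); rewrite lw_comp (reassoc2 (lwK (lwK (assocVK _ _ _)))) comp1m.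
rewrite -lw_comp; congr (_ \lw _).
by rewrite (reassoc2 (esym assoc_lw)) -?compmA (reassoc2 (esym rw_lw)) -?compmA evr_zigzag_dual compm1.
Qed.

Lemma unrotK P W X (s : Hom (dual X) (dual P \ox W)) : rot_in (unrot s) = s.
Proof.
apply: rw_inj; rewrite rot_in_rw half_in_unrot lw_comp -?compmA -cup_nat.
by rewrite (reassoc2 evr_zigzag_dual) comp1m (reassoc2 (assocK _ _ _)) comp1m.
Qed.

Lemma half_out_cap {P W X} {b : Hom (W \ox X) P} {A} :
  (P \lw cap (ev X) A) \oc half_out b (X \ox A) = (b \rw A) \oc assocV W X A.
Proof.
rewrite /half_out (reassoc2 (esym rw_lw)) -?compmA (reassoc2 (esym assocV_lw)) -?compmA.
by rewrite (lwK ev_zigzag) compm1.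
Qed.

Lemma half_in_cup {P W X} {a : Hom P (W \ox X)} {A} :
  half_in a (X \ox A) \oc (P \lw cup (coevr X) A) = assoc W X A \oc (a \rw A).
Proof.
by rewrite /half_in -?compmA rw_lw (reassoc2 assoc_lw) -?compmA (reassoc2 (lwK evr_zigzag)) comp1m.
Qed.

(** Both sides are the value of a left circle [P] next to a left circle [X], with
    [a] and [b] joining them: the cups and caps of the two circles commute by
    naturality, and contracting [X] or [P] first gives one side or the other. *)
Lemma rot_loop {P W X} {a : Hom P (W \ox X)} {b : Hom (W \ox X) P} {A} :
  cap (ev X) A \oc (((rot_out b \oc rot_in a) \rw (X \ox A)) \oc cup (coevr X) A)
  = cap (ev P) A \oc ((dual P \lw ((b \oc a) \rw A)) \oc cup (coevr P) A).
Proof.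
rewrite rw_comp rot_out_rw rot_in_rw -?compmA (reassoc2 (assocVK _ _ _)) comp1m.
rewrite (reassoc2 (esym cap_nat)) -?compmA (reassoc2 (lw_eq half_out_cap)).
rewrite cup_nat (reassoc2 (lw_eq half_in_cup)).
have E : (b \rw A) \oc assocV W X A \oc (assoc W X A \oc (a \rw A)) =
    (b \oc a) \rw A.
  by rewrite -?compmA (reassoc2 (assocK _ _ _)) comp1m rw_comp.
by rewrite (reassoc2 (lw_eq E)).
Qed.

Lemma rot_inD P W X (a a' : Hom P (W \ox X)) :
  rot_in (a + a') = rot_in a + rot_in a'.
Proof.
by apply: rw_inj; rewrite rwD !rot_in_rw /half_in rwD !(compmD, lwD, compDm).
Qed.

Lemma rot_inZ P W X c (a : Hom P (W \ox X)) : rot_in (c *: a) = c *: rot_in a.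
Proof.
by apply: rw_inj; rewrite rwZ !rot_in_rw /half_in rwZ !(compmZ, lwZ, compZm).
Qed.

Lemma rot_in_sum P W X J (r : seq J) (Q : pred J) (F : J -> Hom P (W \ox X)) :
  rot_in (\sum_(i <- r | Q i) F i) = \sum_(i <- r | Q i) rot_in (F i).
Proof.
apply: (big_morph (@rot_in P W X) (@rot_inD P W X)).
by rewrite -(scale0r 0) rot_inZ scale0r.
Qed.

(** A loop around [Z] and to the left of [W], coloured by [P], where [T] is applied
    to the returning strand [dual P] together with [W]. The sum of these over a
    family of [T] that adds up to the identity is the plain loop. *)
Definition loop_ins Z P W A (T : Hom (dual P \ox W) (dual P \ox W)) :
    Hom (Z \ox (W \ox A)) (Z \ox (W \ox A)) :=
  (Z \lw cap (evr P) (W \ox A)) \oc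
    ((Z \lw (P \lw (assoc (dual P) W A \oc ((T \rw A) \oc assocV (dual P) W A))))
      \oc (dbraid Z P _ \oc (Z \lw cup (coev P) (W \ox A)))).

Arguments loop_ins Z P W A T : clear implicits.

Lemma loop_insD Z P W A T T' :
  loop_ins Z P W A (T + T') = loop_ins Z P W A T + loop_ins Z P W A T'.
Proof. by rewrite /loop_ins rwD !(compDm, compmD, lwD). Qed.

Lemma loop_insZ Z P W A c T :
  loop_ins Z P W A (c *: T) = c *: loop_ins Z P W A T.
Proof. by rewrite /loop_ins rwZ !(compZm, compmZ, lwZ). Qed.

Lemma loop_ins_sum Z P W A J (r : seq J) (Q : pred J) F :
  loop_ins Z P W A (\sum_(i <- r | Q i) F i) =
  \sum_(i <- r | Q i) loop_ins Z P W A (F i).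
Proof.
apply: (big_morph (@loop_ins Z P W A) (@loop_insD Z P W A)).
by rewrite -(scale0r 0) loop_insZ scale0r.
Qed.

Lemma loop_ins1 Z P W A : loop_ins Z P W A (idm _) = loop j Z P \rw (W \ox A).
Proof. by rewrite /loop_ins rw1 comp1m assocVK !lw1 comp1m loop_rw. Qed.

Lemma loop_ins_rot Z P W X A (a : Hom P (W \ox X)) (b : Hom (W \ox X) P) :
  (Z \lw half_in a A) \oc (dbraid Z P (dual X \ox A) \oc (Z \lw half_out b A)) =
  loop_ins Z P W A (rot_in a \oc rot_out b).
Proof.
rewrite half_in_rot half_out_rot /loop_ins rw_comp !lw_comp -?compmA.
by rewrite (reassoc2 dbraid_nat) -?compmA (reassoc2 dbraid_nat) -?compmA.
Qed.

(** The double braiding of [Z] with [W \ox X] passes [W] first and last, and [X]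
    in between. So closing up [X] alone leaves the loop [X] around [Z],
    between two crossings of [Z] with [W]. *)
Lemma loop_cross Z W X A :
  swap W Z A \oc ((W \lw (loop j Z X \rw A)) \oc swap Z W A) =
  (Z \lw (W \lw cap (evr X) A)) \oc ((Z \lw assoc W X (dual X \ox A)) \oc
    (dbraid Z (W \ox X) (dual X \ox A) \oc ((Z \lw assocV W X (dual X \ox A)) \oc
      (Z \lw (W \lw cup (coev X) A))))).
Proof.
rewrite loop_rw !lw_comp -?compmA (reassoc2 swap_nat) -?compmA -swap_nat.
by rewrite (reassoc2 dbraid_tens) -?compmA (reassoc2 (lwK (assocVK _ _ _))) comp1m.
Qed.

End Rotation.

Arguments rot_out {K C P W X} b.
Arguments rot_in {K C} j {P W X} a.
Arguments unrot {K C} j {P W X} s.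
Arguments half_out {K C P W X} b A.
Arguments half_in {K C} j {P W X} a A.
Arguments loop_ins {K C} j Z P W A T.

Section Killing.
Context {K : closedFieldType} {C : braided_fusion_category K}
  {j : pivotal_structure C}.
Implicit Types P X Y Z W V A B : C.
Local Notation I := (unit_ob C).
Local Notation d := (pivotal_dim j).
Local Notation rank := (fusion_rank C).

Definition len V : nat := projT1 (cid (decompositionP V)).
Definition kind V : 'I_(len V) -> 'I_rank :=
  projT1 (cid (projT2 (cid (decompositionP V)))).
Definition incl V : forall i, 'I_(len V) -> Hom (irr i) V :=
  projT1 (cid (projT2 (cid (projT2 (cid (decompositionP V)))))).
Definition proj V : forall i, 'I_(len V) -> Hom V (irr i) :=
  projT1 (cid (projT2 (cid (projT2 (cid (projT2 (cid (decompositionP V)))))))).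

Lemma kindP V : decomposition (@kind V) (@incl V) (@proj V).
Proof.
exact: projT2 (cid (projT2 (cid (projT2 (cid (projT2 (cid (decompositionP V)))))))).
Qed.

Lemma proj_incl V p i : @kind V p = i -> proj i p \oc incl i p = idm (irr i).
Proof. by move=> <-; have [+ _ _] := kindP V; apply. Qed.

Lemma proj_incl0 V p q i : @kind V p = i -> kind q = i -> p <> q ->
  proj i q \oc incl i p = 0.
Proof. by have [_ + _] := kindP V; apply. Qed.

Lemma dual_irr_cover i : exists i', isomorphic (dual (irr i') : C) (irr i).
Proof.
have [i' [f [g [gf fg]]]] :=
  schurian_irr (dual_schurian (simple_schurian (irr_simple (C := C) i))).
exists i', (pivV j _ \oc dualm f), (dualm g \oc j (irr i)); split.
- rewrite -compmA (reassoc2 (pivVK _)) comp1m -dualm_comp.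
  by rewrite fg dualm1.
- rewrite -compmA (_ : dualm f \oc _ = j _) ?pivK //.
  by rewrite compmA -dualm_comp gf dualm1 comp1m.
Qed.

Hypothesis dI : d I = 1.
Hypothesis dim_dual : forall X, d X = d (dual X).

(** It suffices to compose with a map [s] from some [dual (irr i)]. Every such [s]
    is a combination of rotated inclusions, by decomposing [unrot s]. On a
    rotated inclusion the composites with the rotated projections are scalars,
    computed by [rot_loop]: they vanish unless the two indices agree, and then
    equal the ratio of the dimensions of [irr k] and [irr i]. *)
Lemma rot_dual_bases W k :
  \sum_i \sum_(p | @kind (W \ox irr i) p == k)
     d (irr i) *: (rot_in j (incl k p) \oc rot_out (proj k p))
  = d (irr k) *: idm (dual (irr k) \ox W).
Proof.
set T := \sum_i _.
have test i (s : Hom (dual (irr i)) (dual (irr k) \ox W)) : T \oc s = d (irr k) *: s.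
  rewrite -(unrotK (j := j) s) (decomposition_irr (unrot j s) (kindP _)).
  rewrite rot_in_sum compm_sum scaler_sumr; apply: eq_bigr => q /eqP kq.
  have [a ->] := schur (proj k q \oc unrot j s) (irr_simple k).
  rewrite compmZ compm1 rot_inZ compmZ scalerA mulrC -scalerA; congr (_ *: _).
  rewrite /T comp_summ (bigD1 i) //= [X in _ + X]big1 => [|i' i'i].
    rewrite addr0 comp_summ.
    (* Both sides of [rot_loop] are multiples of circles, whence the weights. *)
    have scalp p : kind p == k ->
        d (irr i) *: (rot_out (proj k p) \oc rot_in j (incl k q)) =
        (if p == q then d (irr k) else 0) *: idm (dual (irr i)).
      move=> /eqP kp.
      have [_ sc] := dual_schurian (simple_schurian (irr_simple (C := C) i)).
      have [c rot_c] := sc (rot_out (proj k p) \oc rot_in j (incl k q)).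
      have := rot_loop (j := j) (a := incl k q) (b := proj k p) (A := I).
      rewrite rot_c rwZ rw1 compZm comp1m compmZ dim_dual_circle // -dim_dual.
      rewrite scalerA mulrC scalerA => E; congr (_ *: _).
      apply: (@idI_inj _ C); rewrite E.
      case: eqP => [->|pq]; last first.
        by rewrite proj_incl0 //; [rewrite rw0 lw0 comp0m compm0 scale0r|move=> /esym].
      by rewrite proj_incl // rw1 lw1 comp1m dim_dual_circle // -dim_dual.
    rewrite (bigD1 q) ?kq //= [X in _ + X]big1 => [|p /andP[kp /negPf pq]].
      by rewrite addr0 compZm -compmA -compmZ scalp ?kq // eqxx compmZ compm1.
    by rewrite compZm -compmA -compmZ scalp // pq scale0r compm0.
  (* For different [i] the composite is the dual of a map between different
     simple objects. *)
  rewrite comp_summ big1 // => p _.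
  rewrite compZm -compmA (_ : rot_out _ \oc _ = 0) ?compm0 ?scaler0 //.
  have [g ->] := dualmP (rot_out (proj k p) \oc rot_in j (incl k q)).
  by rewrite (irr_hom0 g) ?dualm0 //; apply/eqP.
have [_ _ D] := kindP (dual (irr k) \ox W).
rewrite -[T]compm1 -D compm_sum scaler_sumr; apply: eq_bigr => r _.
have [i [u [v [vu uv]]]] := dual_irr_cover (kind r).
rewrite -[incl _ r]compm1 -uv -!compmA (reassoc2 (erefl (incl _ r \oc u))).
by rewrite (reassoc2 (test _ _)) compZm.
Qed.

Definition loopval Z V : K := scal (loop j Z V).

Lemma loopvalE Z V : schurian Z -> loop j Z V = loopval Z V *: idm Z.
Proof. exact: scalE. Qed.

(** The handle slide: the loop around [Z] coloured by all simple objects, weighted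
    by their dimensions, absorbs a strand [W] that crosses [Z]. *)
Lemma killing Z W A : schurian Z ->
  (\sum_i d (irr i) * loopval Z (irr i)) *: dbraid Z W A =
  (\sum_i d (irr i) * loopval Z (irr i)) *: idm (Z \ox (W \ox A)).
Proof.
move=> sZ; rewrite !scaler_suml.
(* The left side, cut along the decompositions of the [W \ox irr i]. *)
transitivity (\sum_i \sum_(p < len (W \ox irr i)) loop_ins j Z (irr (kind p)) W A
   (d (irr i) *: (rot_in j (incl (kind p) p) \oc rot_out (proj (kind p) p)))).
  apply: eq_bigr => i _.
  have := loop_cross (j := j) Z W (irr i) A.
  rewrite loopvalE // rwZ rw1 lwZ lw1 compZm comp1m compmZ swap_swap.
  rewrite -scalerA => ->.
  have [_ _ D] := kindP (W \ox irr i).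
  rewrite -[dbraid Z (W \ox _) _]compm1 -lw1 -rw1 -D rw_sum lw_sum compm_sum.
  rewrite comp_summ !compm_sum scaler_sumr; apply: eq_bigr => p _.
  rewrite loop_insZ -loop_ins_rot; congr (_ *: _).
  rewrite rw_comp lw_comp (reassoc2 dbraid_lw) -?compmA.
  by rewrite /half_in /half_out !lw_comp -?compmA.
(* The pieces regrouped by the simple object [irr k] along which they are cut. *)
transitivity (\sum_k \sum_i \sum_(p | @kind (W \ox irr i) p == k)
    loop_ins j Z (irr k) W A
      (d (irr i) *: (rot_in j (incl k p) \oc rot_out (proj k p)))).
  rewrite exchange_big /=; apply: eq_bigr => i _.
  rewrite (partition_big (@kind (W \ox irr i)) xpredT) //=.
  by apply: eq_bigr => k _; apply: eq_bigr => p /eqP <-.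
apply: eq_bigr => k _.
under eq_bigr do rewrite -loop_ins_sum.
rewrite -loop_ins_sum rot_dual_bases loop_insZ loop_ins1 loopvalE // rwZ rw1.
by rewrite scalerA.
Qed.

End Killing.

(** * Subcategories generated by the unit *)

Section VecUnit.
Context {K : closedFieldType} {C : fusion_category K}.
Implicit Types X Y V : C.
Local Notation I := (unit_ob C).

(** The multiples of the unit, described without choosing a biproduct so that
    closure under tensor products and duals is immediate. *)
Definition unit_generated : set C := [set V | exists (J : finType)
  (a : J -> Hom I V) (b : J -> Hom V I), \sum_p (a p \oc b p) = idm V].

Lemma dual_unit_iso : exists (u : Hom I (dual I)) (w : Hom (dual I) I),
  u \oc w = idm (dual I).
Proof.
pose u : Hom I (dual I) := runit _ \oc counitV I.
pose w : Hom (dual I) I := counit I \oc runitV _.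
have wu : w \oc u = idm I.
  by rewrite /w /u -compmA (reassoc2 (runitK _)) comp1m counitVK.
exists u, w; have [_ sc] := dual_schurian (unit_schurian (C := C)).
have [c cE] := sc (u \oc w); rewrite cE.
have : w \oc (u \oc w) \oc u = idm I by rewrite compmA wu comp1m.
rewrite cE compmZ compm1 compZm wu -[RHS]scale1r => /(scalar_inj (@idI_neq0 _ C)) ->.
by rewrite scale1r.
Qed.

Lemma unit_generated_fusion : fusion_subcategory unit_generated.
Proof.
split.
- exists unit, (fun=> idm I), (fun=> idm I).
  by rewrite (big_pred1 tt) ?comp1m // => -[].
- move=> X Y [J [a [b ab]]] [J' [a' [b' ab']]].
  exists (J * J')%type, (fun p => (a p.1 \om a' p.2) \oc lunitV I),
    (fun p => lunit I \oc (b p.1 \om b' p.2)).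
  rewrite -tensm1 -/(lw _ _) -ab' lw_sum -[RHS]comp1m -rw1 -ab rw_sum.
  rewrite comp_summ -(pair_bigA _ (fun p q => a p \om a' q \oc lunitV I \oc
    (lunit I \oc (b p \om b' q)))) /=.
  apply: eq_bigr => p _; rewrite compm_sum; apply: eq_bigr => q _.
  rewrite -compmA (reassoc2 (lunitK _)) comp1m -tensm_comp tensmE. by [].
- move=> X [J [a [b ab]]]; have [u [w uw]] := dual_unit_iso.
  exists J, (fun p => dualm (b p) \oc u), (fun p => w \oc dualm (a p)).
  rewrite -dualm1 -ab dualm_sum; apply: eq_bigr => p _.
  by rewrite -compmA (reassoc2 uw) comp1m dualm_comp.
- move=> n Xs X [inj [proj [projK _ injK]]]; split=> [[J [a [b ab]]] k|H].
    exists J, (fun p => proj k \oc a p), (fun p => b p \oc inj k).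
    rewrite -projK -[in RHS](comp1m (inj k)) -ab comp_summ compm_sum.
    by apply: eq_bigr => p _; rewrite -!compmA.
  have {}H k : {J : finType & {a : J -> Hom I (Xs k) &
      {b : J -> Hom (Xs k) I | \sum_p (a p \oc b p) = idm (Xs k)}}}.
    have [J /cid[a /cid[b ab]]] := cid (H k).
    by exists J, a, b.
  pose J k : finType := projT1 (H k).
  pose a k : J k -> Hom I (Xs k) := projT1 (projT2 (H k)).
  pose b k : J k -> Hom (Xs k) I := projT1 (projT2 (projT2 (H k))).
  have ab k : \sum_p (a k p \oc b k p) = idm (Xs k) := projT2 (projT2 (projT2 (H k))).
  exists {k : 'I_n & J k}, (fun p => inj (tag p) \oc a _ (tagged p)),
    (fun p => b _ (tagged p) \oc proj (tag p)).
  rewrite -injK -(sig_big_dep xpredT (fun=> xpredT) (fun k (p : J k) =>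
    inj k \oc a k p \oc (b k p \oc proj k))) /=.
  apply: eq_bigr => k _; rewrite -[in RHS](comp1m (proj k)) -ab comp_summ compm_sum.
  by apply: eq_bigr => p _; rewrite -!compmA.
Qed.

(** The identity of such an object is a sum of maps through the unit; one of them
    is not zero, and then it is invertible. *)
Lemma Vec_unit X : Vec C X -> schurian X -> isomorphic X I.
Proof.
move=> VX [nz sc].
have [J [a [b ab]]] : unit_generated X.
  apply: VX; split; first exact: unit_generated_fusion.
  by move=> _ ->; apply: fusub_unit unit_generated_fusion.
have [p abp] : exists p, a p \oc b p <> 0.
  apply: contrapT => E; apply: nz; rewrite -ab big1 // => p _.
  by apply: contrapT => Ep; apply: E; exists p.
have [c cE] := sc (a p \oc b p).
have [c' cE'] := unit_schurian.2 (b p \oc a p).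
have c0 : c != 0 by apply: contra_notN abp => /eqP c0; rewrite cE c0 scale0r.
have cc : c' = c.
  apply: (mulIf c0); apply: (scalar_inj nz).
  have := compmA (a p) (b p) (a p \oc b p); rewrite (reassoc2 cE').
  by rewrite compZm comp1m compmZ cE compZm comp1m !scalerA.
exists (b p), (c^-1 *: a p); rewrite compZm compmZ cE cE' cc !scalerA.
by rewrite mulVf // !scale1r.
Qed.

End VecUnit.

(** * The dimension formula *)

Section Main.
Context {K : closedFieldType} (C : premodular_category K).
Implicit Types X Y Z V : C.
Local Notation I := (unit_ob C).
Local Notation j := (spherical C).
Local Notation d := (@catdim K C).
Local Notation h := (@loopval K C j).

Lemma loop_iso Z X Y : isomorphic X Y -> loop j Z X = loop j Z Y.
Proof.
case=> f [g [gf fg]].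
rewrite (loop_sum (j := j) Z (n := 1) (X := fun=> Y) (f := fun=> g) (g := fun=> f)) //.
  by rewrite big_ord1.
by rewrite big_ord1.
Qed.

Lemma dim_iso X Y : isomorphic X Y -> d X = d Y.
Proof.
case=> f [g [gf fg]].
by rewrite /catdim !dim_tr -gf trC fg.
Qed.

Lemma runit_iso X : isomorphic (X \ox I) X.
Proof. by exists (runit X), (runitV X); rewrite runitK runitVK. Qed.

Lemma loopval_tens Z X Y : schurian Z -> h Z (X \ox Y) = h Z X * h Z Y.
Proof.
move=> sZ; apply: (scalar_inj sZ.1).
by rewrite -loopvalE // (loop_tens X (loopvalE Y sZ)) (loopvalE X sZ) scalerA mulrC.
Qed.

Lemma loopval_kind Z V : schurian Z ->
  h Z V = \sum_(p < len V) h Z (irr (kind p)).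
Proof.
move=> sZ; apply: (scalar_inj sZ.1); rewrite -loopvalE // scaler_suml.
have [gf _ fg] := kindP V.
rewrite (loop_sum Z gf fg); apply: eq_bigr => p _.
exact: loopvalE.
Qed.

Lemma loopval_iso Z X Y : isomorphic X Y -> h Z X = h Z Y.
Proof. by move=> /(loop_iso Z) E; rewrite /loopval E. Qed.

Lemma loopval_sym X Y : schurian X -> schurian Y -> d X * h X Y = d Y * h Y X.
Proof. by move=> sX sY; apply: hopf_sym; apply: loopvalE. Qed.

(** The map [h Z] is a character of the fusion ring, whose structure constants are
    the multiplicities [#|[pred p | kind p == k]|]. *)
Lemma loopval_integral Z i : schurian Z -> algebraic_integer (h Z (irr i)).
Proof.
move=> sZ.
apply: (integral_fusion (h := fun i => h Z (irr i)) (N := fun i i' k =>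
  #|[pred p | @kind K C (irr i \ox irr i') p == k]|)) => {}i i'.
rewrite -loopval_tens // loopval_kind // (partition_big (@kind _ _ _) xpredT) //=.
apply: eq_bigr => k _; rewrite mulr_natl -sumr_const.
by apply: eq_big => [p|p /eqP ->].
Qed.

Hypothesis dI : d I = 1.

(** By multiplicativity [h Z I] is idempotent, and it is not zero because the
    double braiding with the unit is invertible. *)
Lemma loopval_unit Z : schurian Z -> h Z I = 1.
Proof.
move=> sZ; have [nz sc] := sZ.
have h0 : h Z I != 0.
  have [c cE] := sc (runit Z \oc ((braid I Z \oc braid Z I) \oc runitV Z)).
  have bE : braid I Z \oc braid Z I = c *: idm (Z \ox I).
    rewrite -[LHS]compm1 -[LHS]comp1m -!(runitK Z) -!compmA.
    have := congr1 (fun f => runitV Z \oc (f \oc runit Z)) cE.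
    by rewrite -!compmA => ->; rewrite compZm comp1m compmZ runitK.
  have -> : h Z I = c.
    apply: (scalar_inj nz); rewrite -loopvalE //; apply: rw_inj.
    rewrite loop_rw dbraidE bE rwZ rw1 compZm comp1m compmZ assocVK.
    rewrite compZm comp1m compmZ (lw_eq dim_circle) lwZ lw1 rwZ rw1 -/(catdim _) dI.
    by rewrite scale1r.
  apply: contra_notN nz => /eqP c0.
  have [g [gb _]] := braid_iso I Z; have [g' [gb' _]] := braid_iso Z I.
  have ZI0 : idm (Z \ox I) = 0.
    by rewrite -gb' -[braid Z I]comp1m -gb -compmA bE c0 scale0r !compm0.
  by rewrite -(runitVK Z) -[runitV Z]comp1m ZI0 comp0m compm0.
apply: (mulfI h0); rewrite -loopval_tens // mulr1.
exact: loopval_iso (runit_iso I).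
Qed.

(** By duality maps from the unit to [Y \ox dual Y] correspond to endomorphisms of
    [Y], so they are the multiples of [coev Y]: one copy of the unit is needed
    to reach [coev Y], and two copies could not be independent. *)
Lemma kind_unit Y i0 : schurian Y -> isomorphic I (irr i0) ->
  exists p0, forall p, (@kind K C (Y \ox dual Y) p == i0) = (p == p0).
Proof.
move=> [nz sc] [u [v [vu uv]]].
have coev0 : coev Y <> 0.
  move=> E; apply: nz; apply: rw_inj.
  by rewrite rw0 rw1 -ev_zigzag E cup.unlock rw0 comp0m !compm0.
have coevP (f : Hom I (Y \ox dual Y)) : exists x, f = x *: coev Y.
  have [x xE] := sc (bendr (ev Y) f); exists x; apply: cup_inj.
  have : cup f I = (bendr (ev Y) f \rw (dual Y \ox I)) \oc cup (coev Y) I.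
    by rewrite bendr_rw -compmA cup_nat (reassoc2 (lwK ev_zigzag_dual)) comp1m.
  rewrite xE rwZ rw1 compZm comp1m => ->.
  by rewrite cup.unlock rwZ compZm compmZ.
have irr1 : idm (irr i0 : C) <> 0 by apply: simple_idm; apply: irr_simple.
have u0 : u <> 0 by move=> E; apply: irr1; rewrite -uv E comp0m.
have inclP p : @kind K C (Y \ox dual Y) p = i0 ->
    exists2 x, x != 0 & incl i0 p \oc u = x *: coev Y.
  move=> kp; have [x xE] := coevP (incl i0 p \oc u); exists x => //.
  apply: contra_notN u0 => /eqP x0.
  by rewrite -[u]comp1m -(proj_incl kp) -compmA xE x0 scale0r compm0.
have [p0 k0] : exists p0, @kind K C (Y \ox dual Y) p0 = i0.
  apply: contrapT => nk; apply: coev0; rewrite -[coev Y]compm1 -vu compmA.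
  rewrite (decomposition_irr (coev Y \oc v) (kindP _)) big_pred0 ?comp0m //.
  by move=> p; apply/eqP => kp; apply: nk; exists p.
exists p0 => p; apply/eqP/eqP => [kp|->//]; apply: contrapT => pp0.
have [x x0 xE] := inclP _ k0; have [y _ yE] := inclP _ kp.
have pc0 : proj i0 p \oc coev Y = 0.
  apply: (scalerI x0); rewrite -compmZ -xE compmA proj_incl0 //; last exact: nesym.
  by rewrite comp0m scaler0.
apply: u0; rewrite -[u]comp1m -(proj_incl kp) -compmA yE compmZ pc0.
exact: scaler0.
Qed.

Lemma killing_unit (D : set C) (hD : fusion_subcategory D)
    (hDZ : D `&` muger_center C = Vec C) i0 i : isomorphic I (irr i0 : C) ->
  D (irr i) -> i <> i0 -> \sum_k d (irr k) * h (irr i) (irr k) = 0.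
Proof.
move=> isoI Di ii0; apply/eqP/negPn/negP => lam0; apply: ii0.
have sZ := simple_schurian (irr_simple i).
have cent W : centralize (irr i : C) W.
  have := killing (j := j) dI (@sphericalP _ C) W I sZ.
  move=> /(scalerI lam0); rewrite dbraidE => E.
  apply: rw_inj; rewrite rw1 -[LHS]comp1m -[LHS]compm1 -!(assocK (irr i : C) W I).
  by rewrite -!compmA (reassoc3 E) comp1m.
have : Vec C (irr i).
  rewrite -hDZ; split=> //; move=> E [fE]; apply; split=> //.
  exact: irr_simple.
move=> /Vec_unit /(_ sZ) [f [f' [ff' f'f]]].
have [_ + _] := irrP (C := C); apply.
have [u [v [vu uv]]] := isoI.
exists (u \oc f), (f' \oc v); split.
- by rewrite -compmA (reassoc2 vu) comp1m.
- by rewrite -compmA (reassoc2 f'f) comp1m.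
Qed.

Lemma global_dim_loops (D : set C) (hD : fusion_subcategory D)
    (hDZ : D `&` muger_center C = Vec C) Y : D Y -> schurian Y ->
  global_dim C = d Y ^+ 2 * \sum_i h Y (irr i) * h (dual Y) (irr i).
Proof.
move=> DY sY; have sY' := dual_schurian sY.
have sI i : schurian (irr i : C) := simple_schurian (irr_simple i).
have [i0 isoI] := schurian_irr (unit_schurian (C := C)).
have [p0 kp0] := kind_unit sY isoI.
have DV p : D (irr (@kind K C (Y \ox dual Y) p)).
  have DYY := fusub_tens hD DY (fusub_dual hD DY).
  exact: ((fusub_sum hD (decomposition_sum (kindP _))).1 DYY p).
rewrite mulr_sumr.
(* The Hopf link moves the weights from [Y] and [dual Y] to [irr i]; [sphericalP]
   identifies [d Y] and [d (dual Y)]. *)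
transitivity (\sum_i d (irr i) * d (irr i) * h (irr i) (Y \ox dual Y)); last first.
  apply: eq_bigr => i _; rewrite loopval_tens //.
  have E := loopval_sym (sI i) sY; have E' := loopval_sym (sI i) sY'.
  rewrite expr2 mulrACA E E' {2}/catdim -sphericalP.
  by rewrite mulrACA.
under eq_bigr => i _ do rewrite loopval_kind // mulr_sumr.
rewrite exchange_big /=.
transitivity (\sum_p d (irr (@kind K C (Y \ox dual Y) p)) *
    \sum_i d (irr i) * h (irr (kind p)) (irr i)); last first.
  apply: eq_bigr => p _; rewrite mulr_sumr; apply: eq_bigr => i _.
  by rewrite -mulrA (loopval_sym (sI i) (sI _)) mulrCA.
rewrite (bigD1 p0) //= [X in _ + X]big1 ?addr0 => [|p pp0]; last first.
  rewrite (killing_unit hD hDZ isoI (DV p)) ?mulr0 // => /eqP.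
  by rewrite kp0 (negPf pp0).
have /eqP -> : kind p0 == i0 by rewrite kp0.
rewrite mulr_sumr; apply: eq_bigr => i _.
rewrite mulrCA (loopval_sym (sI _) (sI i)) expr2; congr (_ * _).
rewrite -(loopval_iso _ isoI) loopval_unit ?mulr1 //.
Qed.

End Main.

Lemma integral_global_dim (K : closedFieldType) (C : premodular_category K)
    (D : set C) (hD : fusion_subcategory D)
    (hDZ : D `&` muger_center C = Vec C) (Y : C) :
  D Y -> simple_object Y -> algebraic_integer (global_dim C / catdim Y ^+ 2).
Proof.
move=> DY sY; have {}sY := simple_schurian sY.
have [->|dY] := eqVneq (catdim Y) 0.
  by rewrite expr0n invr0 mulr0; apply: integral0.
have dI : catdim (unit_ob C) = 1.
  apply: (mulfI dY); rewrite mulr1 -[in RHS](dim_iso (runit_iso Y)).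
  by rewrite /catdim dim_tens.
rewrite (global_dim_loops dI hD hDZ DY sY) mulrAC mulfV ?expf_neq0 // mul1r.
elim/big_ind: _ => [|x y|i _]; first exact: integral0.
  exact: integral_add.
by apply: integral_mul; apply: loopval_integral => //; apply: dual_schurian.
Qed.

Theorem theorem1p1 (R : realType) (C : premodular_category (R[i])%C)
    (D : set C) (hD : fusion_subcategory D)
    (hDZ : D `&` muger_center C = Vec C)
    (Y : C) (hY : D Y) (hYs : simple_object Y) :
  algebraic_integer (global_dim C / catdim Y ^+ 2).
Proof. exact: integral_global_dim hD hDZ Y hY hYs. Qed.
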